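(* Let $P,Q\in\mathcal{G}_n$ be such that $\|P-Q\|_\infty<1/\sqrt2$, and let $t\in(0,1)$. Then the set $$\mathcal{M}_t(P,Q)=\{R\in\mathcal{G}_n: d_\infty(P,R)=t\,d_\infty(P,Q)\ \text{ and }\ d_\infty(R,Q)=(1-t)\,d_\infty(P,Q)\}$$ is geodesically convex.
   Context: $\mathcal{G}_n$ is the set of orthogonal projections in $M_n(\mathbb{C})$ (the Grassmannian) and $\|\cdot\|_\infty$ the spectral (operator) norm. $d_\infty(P,Q)$ is the infimum of the lengths $L(\delta)=\int_0^1\|\dot\delta(t)\|_\infty dt$ of piecewise smooth curves $\delta:[0,1]\to\mathcal{G}_n$ joining $P$ with $Q$ (for projections in the same connected component). If $R_0,R_1\in\mathcal{G}_n$ and $\|R_0-R_1\|_\infty<1$, the geodesic joining them is $\gamma(s)=e^{isX}R_0e^{-isX}$, $s\in[0,1]$, where $X$ is the unique Hermitian matrix with $X=R_0X+XR_0$, $\|X\|_\infty<\pi/2$ and $R_1=e^{iX}R_0e^{-iX}$. A set $\mathcal M\subseteq\mathcal{G}_n$ is geodesically convex if for all $R_0,R_1\in\mathcal M$ the geodesic joining them is contained in $\mathcal M$. *)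

(* Defs.v *)
(* MathComp-Analysis.  The real numbers are an arbitrary [R : realType] and the
   complex numbers are [R[i]].  [R[i]] is not a normed module over [R], so
   curves of complex matrices are differentiated entrywise, through real and
   imaginary parts. *)
From HB Require Import structures.
From mathcomp Require Import all_boot all_order all_algebra.
From mathcomp Require Import complex.
From mathcomp Require Import all_classical all_reals all_analysis.
Set Implicit Arguments.
Unset Strict Implicit.
Unset Printing Implicit Defensive.
Import Order.TTheory GRing.Theory Num.Theory.
Import numFieldNormedType.Exports.
Local Open Scope classical_set_scope.
Local Open Scope ring_scope.

Definition grassmannian (R : realType) (n : nat) : set 'M[R[i]]_n :=
  [set P | P *m P = P /\ P \is hermsymmx].
Arguments grassmannian R n : clear implicits.

(* The norm of [R[i]] takes its values in [R[i]], whence [complex.Re]. *)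
Definition l2norm (R : realType) (n : nat) (x : 'cV[R[i]]_n) : R :=
  Num.sqrt (\sum_(i < n) (complex.Re `|x i 0|) ^+ 2).

Definition spectral_norm (R : realType) (n : nat) (A : 'M[R[i]]_n) : R :=
  sup [set l2norm (A *m x) | x in [set x : 'cV[R[i]]_n | l2norm x <= 1]].

Definition expmx (R : realType) (n : nat) (A : 'M[R[i]]_n) : 'M[R[i]]_n :=
  limn (series (fun k : nat => (k`!%:R : R[i])^-1 *: A ^+ k)).

Definition velocity (R : realType) (n : nat) (delta : R -> 'M[R[i]]_n) (t : R) :
    'M[R[i]]_n :=
  \matrix_(i, j) Complex
    (derive1 (fun s : R => complex.Re (delta s i j)) t)
    (derive1 (fun s : R => complex.Im (delta s i j)) t).

Definition smooth (R : realType) (n : nat) (g : R -> 'M[R[i]]_n) : Prop :=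
  forall (i j : 'I_n) (k : nat) (x : R),
    derivable (derive1n k (fun s : R => complex.Re (g s i j))) x 1 /\
    derivable (derive1n k (fun s : R => complex.Im (g s i j))) x 1.

(* Curves are total functions on [R] of which only the restriction to [0, 1]
   matters.  Being smooth on a closed piece means extending to a smooth
   function; as consecutive closed pieces share a breakpoint, a piecewise
   smooth curve is continuous on [0, 1]. *)
Definition piecewise_smooth (R : realType) (n : nat)
    (delta : R -> 'M[R[i]]_n) : Prop :=
  exists s : seq R, itv_partition 0 1 s /\
    forall k : nat, (k < size s)%N ->
      exists g : R -> 'M[R[i]]_n, smooth g /\
        forall x : R, (0 :: s)`_k <= x <= s`_k -> delta x = g x.

(* The velocity is meaningful outside the finite, hence negligible, set of
   breakpoints and endpoints. *)
Definition curve_length (R : realType) (n : nat)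
    (delta : R -> 'M[R[i]]_n) : \bar R :=
  (\int[@lebesgue_measure R]_(t in `[0%R, 1%R])
     (spectral_norm (velocity delta t))%:E)%E.

Definition joining_curve (R : realType) (n : nat) (P Q : 'M[R[i]]_n)
    (delta : R -> 'M[R[i]]_n) : Prop :=
  [/\ piecewise_smooth delta,
      forall x : R, 0 <= x <= 1 -> grassmannian R n (delta x),
      delta 0 = P & delta 1 = Q].

(* Equal to [+oo] when [P] and [Q] lie in different connected components. *)
Definition dist_infty (R : realType) (n : nat) (P Q : 'M[R[i]]_n) : \bar R :=
  ereal_inf [set curve_length delta | delta in joining_curve P Q].

Definition geodesic_curve (R : realType) (n : nat) (R0 X : 'M[R[i]]_n) (s : R) :
    'M[R[i]]_n :=
  expmx ((0 +i* s)%C *: X) *m R0 *m expmx (- ((0 +i* s)%C *: X)).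

Definition geodesic_generator (R : realType) (n : nat)
    (R0 R1 X : 'M[R[i]]_n) : Prop :=
  [/\ X \is hermsymmx,
      X = R0 *m X + X *m R0,
      spectral_norm X < pi / 2 &
      R1 = expmx ((0 +i* 1)%C *: X) *m R0 *m expmx (- ((0 +i* 1)%C *: X))].

(* The geodesic between two projections is only defined when they are at
   distance less than 1. *)
Definition is_geodesic (R : realType) (n : nat) (R0 R1 : 'M[R[i]]_n)
    (gamma : R -> 'M[R[i]]_n) : Prop :=
  spectral_norm (R0 - R1) < 1 /\
  exists X : 'M[R[i]]_n,
    geodesic_generator R0 R1 X /\ gamma = geodesic_curve R0 X.

(* "The geodesic joining them" includes its existence. *)
Definition geodesically_convex (R : realType) (n : nat)
    (M : set 'M[R[i]]_n) : Prop :=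
  M `<=` grassmannian R n /\
  forall R0 R1 : 'M[R[i]]_n, M R0 -> M R1 ->
    (exists gamma : R -> 'M[R[i]]_n, is_geodesic R0 R1 gamma) /\
    (forall gamma : R -> 'M[R[i]]_n, is_geodesic R0 R1 gamma ->
       forall s : R, 0 <= s <= 1 -> M (gamma s)).

Definition intermediate_set (R : realType) (n : nat) (t : R)
    (P Q : 'M[R[i]]_n) : set 'M[R[i]]_n :=
  [set S | [/\ grassmannian R n S,
               dist_infty P S = (t%:E * dist_infty P Q)%E &
               dist_infty S Q = ((1 - t)%:E * dist_infty P Q)%E]].

(* Main.v *)
(* For projections [P], [S] put [E = 2 P - 1] and [F = 2 S - 1].  Then
   [<E x, F x> = |x|^2 - 2 |(P - S) x|^2], so [|P - S| <= sin r] says that the vectors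
   [E x] and [F x] of the real sphere are at angle at most [2 r] for every [x].

   This angle between projections satisfies the triangle inequality, and it is the
   distance [d_infty] below [pi / 2].  Indeed a curve [delta] moves [(2 delta(t) - 1) x]
   on the sphere at speed at most [2 |delta'(t)|], while diagonalizing the unitary
   [F E] produces a geodesic of length the angle.

   A ball of radius [r < pi / 4] about [P] is thus the set of symmetries [A] with
   [E A + A E >= 2 cos (2 r)], where [cos (2 r) > 0].  Along a geodesic with generator
   [X], two symmetries [S], [S'] and their midpoint [A] satisfy [S + S' = A B] for some
   [B = 2 cos Y] commuting with [A], [Y] a multiple of [X]; as [0 < B <= 2], this passes
   the bound from [S], [S'] to [A], and a continuity argument gives the convexity of the
   ball.  Finally the set of the theorem is an intersection of two such balls, by the
   triangle inequality. *)
Require Import Defs.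
From HB Require Import structures.
From mathcomp Require Import all_boot all_order all_algebra.
From mathcomp Require Import complex.
From mathcomp Require Import ring lra.
From mathcomp Require Import all_classical all_reals all_analysis.
From mathcomp Require Import measurable_realfun.
Import Order.TTheory GRing.Theory Num.Theory.
Import numFieldNormedType.Exports.
Local Open Scope classical_set_scope.
Local Open Scope ring_scope.
Set Implicit Arguments.
Unset Strict Implicit.
Unset Printing Implicit Defensive.
Local Open Scope sesquilinear_scope.
Local Notation "a %:C" := (real_complex _ a).
Local Notation Re := complex.Re.
Local Notation Im := complex.Im.

(** * Linear algebra over the real inner product *)

Section RealInnerProduct.
Variables (R : realType) (n : nat).
Implicit Types (x y z : 'cV[R[i]]_n) (A B : 'M[R[i]]_n) (a b c : R).

(** The real part of the Hermitian product makes the complex column vectors a real Euclidean space,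
    in which the angle between two vectors is meaningful. *)
Definition rdot x y : R := Re (\sum_(i < n) (x i 0)^* * y i 0).

Lemma ReM_conj (z w : R[i]) : Re (z^* * w) =
  Re z * Re w + Im z * Im w.
Proof. by case: z w => [a b] [c d] /=; rewrite mulNr opprK. Qed.

Lemma rdotE x y : rdot x y = \sum_(i < n)
  (Re (x i 0) * Re (y i 0) + Im (x i 0) * Im (y i 0)).
Proof.
rewrite /rdot raddf_sum; apply: eq_bigr => i _; exact: ReM_conj.
Qed.

Lemma rdotC x y : rdot x y = rdot y x.
Proof. by rewrite !rdotE; apply: eq_bigr => i _; rewrite mulrC [X in _ + X]mulrC. Qed.

Lemma rdotDr x y z : rdot x (y + z) = rdot x y + rdot x z.
Proof.
rewrite /rdot -raddfD -big_split /=; congr Re.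
by apply: eq_bigr => i _; rewrite mxE mulrDr.
Qed.

Lemma rdotZr a x y : rdot x (a%:C *: y) = a * rdot x y.
Proof.
rewrite !rdotE mulr_sumr; apply: eq_bigr => i _; rewrite mxE.
by case: (x i 0) (y i 0) => [xr xi] [yr yi] /=; ring.
Qed.

Lemma rdotNr x y : rdot x (- y) = - rdot x y.
Proof. by rewrite -scaleN1r -(rmorphN1 (real_complex R)) rdotZr mulN1r. Qed.

Lemma rdotDl x y z : rdot (y + z) x = rdot y x + rdot z x.
Proof. by rewrite rdotC rdotDr !(rdotC x). Qed.
Lemma rdotZl a x y : rdot (a%:C *: y) x = a * rdot y x.
Proof. by rewrite rdotC rdotZr (rdotC x). Qed.
Lemma rdotNl x y : rdot (- y) x = - rdot y x.
Proof. by rewrite rdotC rdotNr (rdotC x). Qed.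

Lemma rdot_ge0 x : 0 <= rdot x x.
Proof. by rewrite rdotE sumr_ge0// => i _; rewrite addr_ge0 // -expr2 sqr_ge0. Qed.

Lemma l2normE x : l2norm x = Num.sqrt (rdot x x).
Proof.
rewrite rdotE /l2norm; congr Num.sqrt; apply: eq_bigr => i _.
case: (x i 0) => u v; rewrite normc_def /= sqr_sqrtr ?addr_ge0 ?sqr_ge0 //.
Qed.

Lemma l2norm_sqr x : l2norm x ^+ 2 = rdot x x.
Proof. by rewrite l2normE sqr_sqrtr // rdot_ge0. Qed.

Lemma l2norm_ge0 x : 0 <= l2norm x.
Proof. by rewrite l2normE sqrtr_ge0. Qed.

Lemma rdot_eq0 x : rdot x x = 0 -> x = 0.
Proof.
rewrite rdotE => /eqP; rewrite psumr_eq0 => [/allP h|i _]; last first.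
  by rewrite addr_ge0 // -expr2 sqr_ge0.
apply/colP => i; have := h i (mem_index_enum _).
rewrite -!expr2 paddr_eq0 ?sqr_ge0// !sqrf_eq0 mxE.
by case: (x i 0) => u v /= /andP[/eqP -> /eqP ->].
Qed.

Lemma rdot0r x : rdot x 0 = 0.
Proof. by rewrite /rdot big1 // => i _; rewrite mxE mulr0. Qed.

(** Expand the squared norm of [|y|^2 x - <x, y> y], which is nonnegative, and cancel one factor
    [|y|^2]. *)
Lemma rdot_CS_sqr x y : rdot x y ^+ 2 <= rdot x x * rdot y y.
Proof.
have [y0|] := eqVneq (rdot y y) 0.
  by rewrite (rdot_eq0 y0) !rdot0r mulr0 expr0n.
rewrite neq_lt ltNge rdot_ge0 /= => y0.
rewrite -subr_ge0 -(pmulr_rge0 _ y0).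
have := rdot_ge0 ((rdot y y)%:C *: x - (rdot x y)%:C *: y).
rewrite !(rdotDl, rdotDr, rdotNl, rdotNr, rdotZl, rdotZr) (rdotC y x).
by congr (_ <= _); ring.
Qed.

Lemma rdot_CS x y : `|rdot x y| <= l2norm x * l2norm y.
Proof.
rewrite -(ler_pXn2r (n:=2)) ?nnegrE ?mulr_ge0 ?l2norm_ge0 //.
by rewrite exprMn !l2norm_sqr real_normK ?num_real // rdot_CS_sqr.
Qed.

Lemma l2normD x y : l2norm (x + y) <= l2norm x + l2norm y.
Proof.
rewrite -(ler_pXn2r (n:=2)) ?nnegrE ?addr_ge0 ?l2norm_ge0 //.
rewrite sqrrD !l2norm_sqr !(rdotDl, rdotDr) (rdotC y x).
have := le_trans (ler_norm _) (rdot_CS x y); lra.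
Qed.

Lemma l2normZ a x : l2norm (a%:C *: x) = `|a| * l2norm x.
Proof. by rewrite !l2normE rdotZl rdotZr mulrA -expr2 sqrtrM ?sqr_ge0 // sqrtr_sqr. Qed.

Lemma l2normN x : l2norm (- x) = l2norm x.
Proof. by rewrite !l2normE rdotNl rdotNr opprK. Qed.

Lemma l2norm0 : l2norm (0 : 'cV[R[i]]_n) = 0.
Proof. by rewrite l2normE rdot0r sqrtr0. Qed.

Lemma rdot_adj A x y : rdot x (A *m y) = rdot (A ^t* *m x) y.
Proof.
rewrite /rdot; congr Re.
under eq_bigr do rewrite mxE mulr_sumr.
rewrite exchange_big /=; apply: eq_bigr => j _.
rewrite mxE rmorph_sum mulr_suml; apply: eq_bigr => i _.
by rewrite !mxE rmorphM /= conjCK mulrCA mulrA.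
Qed.

End RealInnerProduct.

(** * Spectral norm *)

Section SpectralNorm.
Variables (R : realType) (n : nat).
Implicit Types (x y : 'cV[R[i]]_n) (A B : 'M[R[i]]_n) (c : R).

(** A crude norm that dominates the spectral norm up to a factor 2. It shows that the supremum is
    finite and that the speed of a smooth curve is continuous. *)
Definition entry_sum A : R := \sum_i \sum_j (`|Re (A i j)| + `|Im (A i j)|).

Lemma Re_entry_le x i : `|Re (x i 0)| <= l2norm x.
Proof.
rewrite -(ler_pXn2r (n:=2)) ?nnegrE ?l2norm_ge0 // l2norm_sqr real_normK ?num_real //.
rewrite rdotE (bigD1 i) //= -addrA expr2 lerDl addr_ge0 ?sumr_ge0 // -?expr2 ?sqr_ge0 //.
by move=> j _; rewrite addr_ge0 // -expr2 sqr_ge0.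
Qed.

Lemma Im_entry_le x i : `|Im (x i 0)| <= l2norm x.
Proof.
rewrite -(ler_pXn2r (n:=2)) ?nnegrE ?l2norm_ge0 // l2norm_sqr real_normK ?num_real //.
rewrite rdotE (bigD1 i) //= addrAC expr2 lerDr addr_ge0 ?sumr_ge0 // -?expr2 ?sqr_ge0 //.
by move=> j _; rewrite addr_ge0 // -expr2 sqr_ge0.
Qed.

Lemma l2norm_le_sum x : l2norm x <= \sum_i (`|Re (x i 0)| + `|Im (x i 0)|).
Proof.
have s0 : 0 <= \sum_i (`|Re (x i 0)| + `|Im (x i 0)|) by rewrite sumr_ge0.
rewrite -(ler_pXn2r (n:=2)) ?nnegrE ?l2norm_ge0 // l2norm_sqr expr2 mulr_suml rdotE.
apply: ler_sum => i _.
have h : `|Re (x i 0)| + `|Im (x i 0)| <= \sum_i (`|Re (x i 0)| + `|Im (x i 0)|).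
  by rewrite [leRHS](bigD1 i) //= lerDl sumr_ge0.
apply: le_trans (ler_wpM2l _ h); last by rewrite addr_ge0.
rewrite -!expr2 -(real_normK (num_real (Re _))) -(real_normK (num_real (Im _))).
rewrite sqrrD; have : 0 <= `|Re (x i 0)| * `|Im (x i 0)| by rewrite mulr_ge0.
lra.
Qed.

Lemma l2norm_mulmx_entry_sum A x : l2norm (A *m x) <= 2 * entry_sum A * l2norm x.
Proof.
apply: le_trans (l2norm_le_sum _) _.
rewrite /entry_sum -mulrA mulr_suml mulr_sumr; apply: ler_sum => i _.
rewrite mxE mulr_suml mulr_sumr !raddf_sum.
apply: le_trans (lerD (ler_norm_sum _ _ _) (ler_norm_sum _ _ _)) _.
rewrite -big_split /=; apply: ler_sum => j _.
move: (Re_entry_le x j) (Im_entry_le x j).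
case: (A i j) (x j 0) => [a b] [u v] /= hu hv.
have h1 : `|a * u - b * v| <= `|a| * l2norm x + `|b| * l2norm x.
  by apply: le_trans (ler_normB _ _) _; rewrite !normrM lerD // ler_wpM2l.
have h2 : `|a * v + b * u| <= `|a| * l2norm x + `|b| * l2norm x.
  by apply: le_trans (ler_normD _ _) _; rewrite !normrM lerD // ler_wpM2l.
by apply: le_trans (lerD h1 h2) _; rewrite -mulrDl; lra.
Qed.

Lemma entry_sum_ge0 A : 0 <= entry_sum A.
Proof. by apply: sumr_ge0 => i _; apply: sumr_ge0 => j _; rewrite addr_ge0. Qed.

Let unit_image A := [set l2norm (A *m x) | x in [set x : 'cV[R[i]]_n | l2norm x <= 1]].

(** [sup] is an upper bound only for nonempty bounded sets; the estimate by [entry_sum] supplies the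
    boundedness. *)
Let unit_image_sup A : has_sup (unit_image A).
Proof.
split; first by exists 0, 0 => /=; rewrite ?mulmx0 l2norm0.
exists (2 * entry_sum A) => _ [x /= x1 <-].
apply: le_trans (l2norm_mulmx_entry_sum A x) _.
by rewrite -[leRHS]mulr1 ler_wpM2l // mulr_ge0 // entry_sum_ge0.
Qed.

Lemma l2norm_mulmx_le A x : l2norm (A *m x) <= spectral_norm A * l2norm x.
Proof.
have [x0|xn0] := eqVneq (l2norm x) 0.
  move: x0; rewrite l2normE => /eqP; rewrite sqrtr_eq0 => x0.
  have -> : x = 0 by apply/rdot_eq0/le_anti; rewrite x0 rdot_ge0.
  by rewrite mulmx0 l2norm0 rdot0r sqrtr0 mulr0.
have x0 : 0 < l2norm x by rewrite lt_def xn0 l2norm_ge0.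
rewrite -ler_pdivrMr //.
have -> : l2norm (A *m x) / l2norm x = l2norm (A *m ((l2norm x)^-1%:C *: x)).
  by rewrite -scalemxAr l2normZ ger0_norm ?invr_ge0 ?l2norm_ge0 // mulrC.
apply: (sup_upper_bound (unit_image_sup A)).
exists ((l2norm x)^-1%:C *: x) => //=.
by rewrite l2normZ ger0_norm ?invr_ge0 ?l2norm_ge0 // mulVf.
Qed.

Lemma spectral_norm_le A c : 0 <= c ->
  (forall x, l2norm (A *m x) <= c * l2norm x) -> spectral_norm A <= c.
Proof.
move=> c0 hc; apply: ge_sup; first by have [] := unit_image_sup A.
move=> _ [x /= x1 <-]; apply: le_trans (hc x) _.
by rewrite -[leRHS]mulr1 ler_wpM2l.
Qed.

Lemma spectral_norm_ge0 A : 0 <= spectral_norm A.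
Proof.
apply: (sup_upper_bound (unit_image_sup A)).
by exists 0; rewrite /= ?mulmx0 l2norm0.
Qed.

Lemma spectral_norm_le_entry_sum A : spectral_norm A <= 2 * entry_sum A.
Proof.
by apply: spectral_norm_le (l2norm_mulmx_entry_sum A); rewrite mulr_ge0 ?entry_sum_ge0.
Qed.

(** Reverse triangle inequality; it transfers entrywise continuity to the spectral norm. *)
Lemma spectral_norm_dist A B : `|spectral_norm A - spectral_norm B| <= 2 * entry_sum (A - B).
Proof.
have h A' B' : spectral_norm A' <= spectral_norm B' + spectral_norm (A' - B').
  apply: spectral_norm_le => [|x]; first by rewrite addr_ge0 ?spectral_norm_ge0.
  rewrite -{1}(subrKC B' A') mulmxDl mulrDl; apply: le_trans (l2normD _ _) _.
  by rewrite lerD ?l2norm_mulmx_le.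
have := h A B; have := h B A.
have -> : spectral_norm (B - A) = spectral_norm (A - B).
  rewrite /spectral_norm; congr sup; apply: eq_set => c; apply: propext.
  by split => -[x x1 <-]; exists x => //; rewrite -l2normN -mulNmx opprB.
by have := spectral_norm_le_entry_sum (A - B); rewrite ler_norml; lra.
Qed.

End SpectralNorm.

(* Locked, since unfolding it makes unification of matrix products very slow. *)
HB.lock Definition udiag (R : realType) (n : nat) (V : 'M[R[i]]_n) (w : 'I_n -> R[i]) :
  'M[R[i]]_n := V ^t* *m diag_mx (\row_j w j) *m V.
Canonical locked_udiag := Unlockable udiag.unlock.

(** * Unitarily diagonalized matrices *)

Section UnitaryDiagonal.
Variables (R : realType) (n : nat).
Implicit Types (x y : 'cV[R[i]]_n) (A V : 'M[R[i]]_n) (w : 'I_n -> R[i]) (d : 'I_n -> R).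

Lemma unitarymxK V : V \is unitarymx -> V ^t* *m V = 1%:M.
Proof. by move=> /unitarymxP/mulmx1C. Qed.

Lemma udiagM V w w' : V \is unitarymx ->
  udiag V w *m udiag V w' = udiag V (fun j => w j * w' j).
Proof.
move=> /unitarymxP VV; rewrite unlock -!mulmxA (mulmxA V (V ^t*)) VV mul1mx.
rewrite (mulmxA (diag_mx _) (diag_mx _)) mulmx_diag; congr (_ *m (diag_mx _ *m _)).
by apply/rowP => j; rewrite !mxE.
Qed.

Lemma udiagD V w w' : udiag V w + udiag V w' = udiag V (fun j => w j + w' j).
Proof.
rewrite unlock -mulmxDl -mulmxDr -raddfD; congr (_ *m diag_mx _ *m _).
by apply/rowP => j; rewrite !mxE.
Qed.

Lemma udiagZ V w a : a *: udiag V w = udiag V (fun j => a * w j).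
Proof.
rewrite unlock scalemxAl scalemxAr -linearZ; congr (_ *m diag_mx _ *m _).
by apply/rowP => j; rewrite !mxE.
Qed.

Lemma udiag1 V : V \is unitarymx -> udiag V (fun=> 1) = 1%:M.
Proof.
move=> /unitarymxK VV; rewrite unlock -[RHS]VV; congr (_ *m _).
by rewrite -[RHS]mulmx1; congr (_ *m _); apply/matrixP => i j; rewrite !mxE.
Qed.

Lemma trmxC_mul (m p q : nat) (A : 'M[R[i]]_(m, p)) (B : 'M[R[i]]_(p, q)) :
  (A *m B) ^t* = B ^t* *m A ^t*.
Proof. by rewrite trmx_mul map_mxM. Qed.

Lemma udiagC V w : (udiag V w) ^t* = udiag V (fun j => (w j)^*).
Proof.
rewrite unlock !trmxC_mul trmxCK mulmxA; congr (_ *m _ *m _).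
rewrite tr_diag_mx map_diag_mx; congr diag_mx.
by apply/rowP => j; rewrite !mxE.
Qed.

Lemma normal_udiag A : A \is normalmx ->
  exists V w, V \is unitarymx /\ A = udiag V w.
Proof.
move=> /orthomx_spectralP eA.
exists (spectralmx A), (fun j => spectral_diag A 0 j); split.
  exact: spectral_unitarymx.
rewrite {1}eA unlock invmx_unitary ?spectral_unitarymx //.
by congr (_ *m diag_mx _ *m _); apply/rowP => j; rewrite !mxE.
Qed.

Lemma hermsymmxC A : A \is hermsymmx -> A ^t* = A.
Proof. by move=> /is_hermitianmxP {2}->; rewrite expr0 scale1r. Qed.

Lemma trmxC_hermsymmx A : A ^t* = A -> A \is hermsymmx.
Proof. by move=> h; apply/is_hermitianmxP; rewrite expr0 scale1r h. Qed.

Lemma hermsymmx_udiag A : A \is hermsymmx ->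
  exists V d, V \is unitarymx /\ A = udiag V (fun j => (d j)%:C).
Proof.
move=> hA; have /orthomx_spectralP eA := hermitian_normalmx hA.
have /mxOverP dA := hermitian_spectral_diag_real hA.
exists (spectralmx A), (fun j => Re (spectral_diag A 0 j)); split.
  exact: spectral_unitarymx.
rewrite {1}eA unlock invmx_unitary ?spectral_unitarymx //.
congr (_ *m diag_mx _ *m _); apply/rowP => j; rewrite !mxE.
by have /complex_realP [k ->] := dA 0 j.
Qed.

Lemma rdot_unitary V x y : V \is unitarymx -> rdot (V *m x) (V *m y) = rdot x y.
Proof. by move=> /unitarymxK VV; rewrite rdot_adj mulmxA VV mul1mx. Qed.

Lemma l2norm_unitary V x : V \is unitarymx -> l2norm (V *m x) = l2norm x.
Proof. by move=> hV; rewrite !l2normE rdot_unitary. Qed.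

Definition sqrn x (j : 'I_n) : R := Re (x j 0) ^+ 2 + Im (x j 0) ^+ 2.

Lemma sqrn_ge0 x j : 0 <= sqrn x j.
Proof. by rewrite addr_ge0 ?sqr_ge0. Qed.

Lemma rdot_sqrn x : rdot x x = \sum_j sqrn x j.
Proof. by rewrite rdotE; apply: eq_bigr => j _; rewrite -!expr2. Qed.

Lemma diag_mx_mulE w x j : (diag_mx (\row_j w j) *m x) j 0 = w j * x j 0.
Proof. by rewrite mul_diag_mx !mxE. Qed.

Lemma rdot_udiag V d x :
  rdot x (udiag V (fun j => (d j)%:C) *m x) = \sum_j d j * sqrn (V *m x) j.
Proof.
rewrite unlock -!mulmxA rdot_adj trmxCK rdotE; apply: eq_bigr => j _.
rewrite diag_mx_mulE /sqrn.
by case: ((V *m x) j 0) => a b /=; ring.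
Qed.

Lemma rdot_sqrn_unitary V x : V \is unitarymx -> rdot x x = \sum_j sqrn (V *m x) j.
Proof. by move=> hV; rewrite -rdot_sqrn rdot_unitary. Qed.

Lemma l2norm_udiag_le V w x (c : R) : V \is unitarymx -> 0 <= c ->
  (forall j, Re (w j) ^+ 2 + Im (w j) ^+ 2 <= c ^+ 2) ->
  l2norm (udiag V w *m x) <= c * l2norm x.
Proof.
move=> hV c0 hw; rewrite unlock -!mulmxA l2norm_unitary ?trmxC_unitary //.
rewrite -[leRHS](@ger0_norm _) ?mulr_ge0 ?l2norm_ge0 //.
rewrite -[leLHS](@ger0_norm _) ?l2norm_ge0 //.
rewrite -(ler_pXn2r (n:=2)) ?nnegrE // !real_normK ?num_real // exprMn !l2norm_sqr.
rewrite (rdot_sqrn_unitary x hV) mulr_sumr rdot_sqrn; apply: ler_sum => j _.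
apply: le_trans (ler_wpM2r (sqrn_ge0 _ _) (hw j)).
rewrite {1}/sqrn diag_mx_mulE /sqrn.
by case: (w j) ((V *m x) j 0) => [a b] [u v] /=; lra.
Qed.

(** The [j]-th column of [V ^t*]: for unitary [V], a unit eigenvector of every [udiag V w]. *)
Definition udiag_vec V (j : 'I_n) : 'cV[R[i]]_n := V ^t* *m delta_mx j 0.

Lemma udiag_vecE V w j : V \is unitarymx ->
  udiag V w *m udiag_vec V j = w j *: udiag_vec V j.
Proof.
move=> /unitarymxP VV; rewrite unlock /udiag_vec -!mulmxA (mulmxA V) VV mul1mx.
rewrite scalemxAr; congr (_ *m _); apply/colP => k.
rewrite diag_mx_mulE !mxE eqxx andbT.
by case: eqVneq => [->|]; rewrite ?mulr0.
Qed.

Lemma rdot_udiag_vec V j : V \is unitarymx ->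
  rdot (udiag_vec V j) (udiag_vec V j) = 1.
Proof.
move=> hV; rewrite rdot_unitary ?trmxC_unitary // rdot_sqrn (bigD1 j) //= big1.
  by rewrite /sqrn !mxE !eqxx /= expr0n expr1n /= !addr0.
by move=> k kj; rewrite /sqrn !mxE (negPf kj) /= expr0n addr0.
Qed.

End UnitaryDiagonal.

(** * Hermitian matrices and anticommutators *)

Section Hermitian.
Variables (R : realType) (n : nat).
Implicit Types (x y : 'cV[R[i]]_n) (A B E S : 'M[R[i]]_n).

Lemma rdot_hermsym A x y : A \is hermsymmx -> rdot (A *m x) y = rdot x (A *m y).
Proof. by move=> /hermsymmxC hA; rewrite rdot_adj hA. Qed.

(** In an orthonormal eigenbasis the quadratic form is the sum of the eigenvalues weighted by
    squared coordinates, so a bound on eigenvectors suffices. The factor [rdot x x] on both sides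
    makes the condition harmless at [x = 0]. *)
Lemma hermsymmx_lower_bound A (m : R) : A \is hermsymmx ->
  (forall x (k : R), A *m x = k%:C *: x -> m * rdot x x <= k * rdot x x) ->
  forall x, m * rdot x x <= rdot x (A *m x).
Proof.
move=> /hermsymmx_udiag [V [d [hV ->]]] h x.
rewrite rdot_udiag (rdot_sqrn_unitary x hV) mulr_sumr; apply: ler_sum => j _.
rewrite ler_wpM2r ?sqrn_ge0 //.
by have := h _ _ (udiag_vecE (fun j => (d j)%:C) j hV); rewrite rdot_udiag_vec // !mulr1.
Qed.

(* The anticommutator [K] of [E] and [A] satisfies [<K x, B x> >= 4 c |x|^2], so on
   an eigenvector of [K] the bound [B <= 2] forces the eigenvalue above [2 c]. *)
Lemma anticommutator_lower_bound E A B S S' (c : R) :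
  E \is hermsymmx -> A \is hermsymmx -> A *m A = 1%:M -> 0 < c ->
  S + S' = A *m B -> A *m B = B *m A ->
  (forall x, 0 <= rdot x (B *m x) <= 2 * rdot x x) ->
  (forall x, c * rdot x x <= rdot (E *m x) (S *m x)) ->
  (forall x, c * rdot x x <= rdot (E *m x) (S' *m x)) ->
  forall x, c * rdot x x <= rdot (E *m x) (A *m x).
Proof.
move=> hE hA AA c0 SS AB hB hS hS' x.
have hEAB y : 2 * c * rdot y y <= rdot (E *m y) (A *m B *m y).
  by rewrite -SS mulmxDl rdotDr; have := hS y; have := hS' y; lra.
pose K := E *m A + A *m E.
have hK : K \is hermsymmx.
  apply: trmxC_hermsymmx; rewrite /K raddfD map_mxD !trmxC_mul.
  by rewrite (hermsymmxC hE) (hermsymmxC hA) addrC.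
have hKB y : 4 * c * rdot y y <= rdot (K *m y) (B *m y).
  (* Since [A] is an isometric involution commuting with [B], the bound at [y] controls
     [<A E y, B y>] and the bound at [A y] controls [<E A y, B y>]; these add up to [<K y, B y>]. *)
  have h1 := hEAB y; have h2 := hEAB (A *m y).
  rewrite -mulmxA -(rdot_hermsym _ _ hA) in h1.
  rewrite (rdot_hermsym _ _ hA) !mulmxA AA mul1mx in h2.
  have e : A *m B *m A = B by rewrite AB -mulmxA AA mulmx1.
  rewrite e in h2.
  by rewrite /K mulmxDl rdotDl -!mulmxA; rewrite -?mulmxA in h1 h2; lra.
suff : 2 * c * rdot x x <= rdot x (K *m x).
  rewrite /K mulmxDl rdotDr -!mulmxA -(rdot_hermsym x (A *m x) hE) -(rdot_hermsym x (E *m x) hA).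
  by rewrite (rdotC (A *m x)); lra.
apply: (hermsymmx_lower_bound hK) => y k hk.
have := hKB y; rewrite hk rdotZl; have /andP[b0 b2] := hB y.
have y0 := rdot_ge0 y.
(* For [k >= 0], the bound [B <= 2] gives [4 c |y|^2 <= 2 k |y|^2]. A negative [k] would make
   [<K y, B y>] nonpositive, which is impossible for [y] nonzero. *)
have [k0|k0] := leP 0 k; first by have := ler_wpM2l k0 b2; lra.
have kb : k * rdot y (B *m y) <= 0 by rewrite mulr_le0_ge0 // ltW.
have [->|yn0] := eqVneq (rdot y y) 0; first by rewrite !mulr0.
have yp : 0 < rdot y y by rewrite lt_def yn0.
by have := mulr_gt0 c0 yp; lra.
Qed.

End Hermitian.

(** * Angles between projections *)

Section Angle.
Variables (R : realType) (n : nat).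
Implicit Types (x y : 'cV[R[i]]_n) (P Q S A : 'M[R[i]]_n) (r a b : R).

Definition refl P : 'M[R[i]]_n := P + P - 1%:M.

Lemma hermsymmx_refl P : grassmannian R n P -> refl P \is hermsymmx.
Proof.
move=> [_ hP]; apply: trmxC_hermsymmx; rewrite /refl.
by rewrite !raddfB !raddfD /= (hermsymmxC hP) trmx1 map_mx1.
Qed.

Lemma reflK P : grassmannian R n P -> refl P *m refl P = 1%:M.
Proof.
move=> [PP _]; rewrite /refl !(mulmxBl, mulmxBr, mulmxDl, mulmxDr) !mulmx1 !mul1mx PP.
by apply/matrixP => i j; rewrite !mxE; ring.
Qed.

Lemma rdot_refl P x y : grassmannian R n P -> rdot (refl P *m x) (refl P *m y) = rdot x y.
Proof.
by move=> hP; rewrite (rdot_hermsym _ _ (hermsymmx_refl hP)) mulmxA reflK // mul1mx.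
Qed.

(* The operator angle between [P] and [S] is at most [r]. *)
Definition angle_le r P S := forall x, l2norm ((P - S) *m x) <= sin r * l2norm x.

(* Since [refl P x] and [refl S x] have the norm of [x], the angle between [P] and [S]
   is half of the largest angle between these two vectors. *)
Lemma rdot_refl2 P S x : grassmannian R n P -> grassmannian R n S ->
  rdot (refl P *m x) (refl S *m x) = rdot x x - 2 * l2norm ((P - S) *m x) ^+ 2.
Proof.
move=> hP hS; rewrite l2norm_sqr.
have h : rdot (refl P *m x - refl S *m x) (refl P *m x - refl S *m x) =
         4 * rdot ((P - S) *m x) ((P - S) *m x).
  have -> : refl P *m x - refl S *m x = (P - S) *m x + (P - S) *m x.
    rewrite -mulmxBl -mulmxDl; congr (_ *m _).
    by apply/matrixP => i j; rewrite !mxE; ring.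
  by rewrite !(rdotDl, rdotDr); ring.
move: h; rewrite !(rdotDl, rdotDr, rdotNl, rdotNr) !rdot_refl //.
by rewrite (rdotC (refl S *m x) (refl P *m x)); lra.
Qed.

(** Square the inequality, which is an equivalence as [0 <= sin r], and use
    [cos (2 r) = 1 - 2 sin^2 r]. *)
Lemma angle_leP r P S : 0 <= sin r -> grassmannian R n P -> grassmannian R n S ->
  angle_le r P S <->
  (forall x, cos (r *+ 2) * rdot x x <= rdot (refl P *m x) (refl S *m x)).
Proof.
move=> r0 hP hS.
have e x : (l2norm ((P - S) *m x) <= sin r * l2norm x) =
  (cos (r *+ 2) * rdot x x <= rdot (refl P *m x) (refl S *m x)).
  rewrite -(ler_pXn2r (n:=2)) ?nnegrE ?mulr_ge0 ?l2norm_ge0 // rdot_refl2 //.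
  rewrite exprMn (l2norm_sqr x) cos_mulr2n cos2sin2.
  by apply/idP/idP; lra.
by split=> h x; [rewrite -e|rewrite e].
Qed.

Lemma angle_le_sym r P S : angle_le r P S -> angle_le r S P.
Proof. by move=> h x; rewrite -l2normN -mulNmx opprB. Qed.

Lemma spectral_norm_angle r P S : 0 <= sin r -> angle_le r P S -> spectral_norm (P - S) <= sin r.
Proof. by move=> r0 h; apply: spectral_norm_le. Qed.

Lemma angle_le_asin P S : spectral_norm (P - S) <= 1 ->
  angle_le (asin (spectral_norm (P - S))) P S.
Proof.
move=> h x; rewrite asinK ?l2norm_mulmx_le // in_itv /= h andbT.
by apply: le_trans (spectral_norm_ge0 _); rewrite lerN10.
Qed.

Lemma rdot_unit_bound x y : rdot x x = 1 -> rdot y y = 1 -> -1 <= rdot x y <= 1.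
Proof.
move=> x1 y1; rewrite -ler_norml; apply: le_trans (rdot_CS _ _) _.
by rewrite !l2normE x1 y1 sqrtr1 mulr1.
Qed.

(** Triangle inequality for angles on the unit sphere. As the cosine decreases on [[0, pi]], [a] and
    [b] may be replaced by the exact angles. *)
Lemma cosD_le_rdot x y z a b : rdot x x = 1 -> rdot y y = 1 -> rdot z z = 1 ->
  0 <= a <= pi -> 0 <= b <= pi -> a + b <= pi ->
  cos a <= rdot x y -> cos b <= rdot y z -> cos (a + b) <= rdot x z.
Proof.
move=> x1 y1 z1 ha hb hab hxy hyz.
have acos_le (c u : R) : 0 <= c <= pi -> -1 <= u <= 1 -> cos c <= u -> 0 <= acos u <= c.
  move=> hc hu hcu; rewrite acos_ge0 //=.
  rewrite leNgt; apply/negP => lt_c; move: hcu; rewrite leNgt => /negP; apply.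
  rewrite -{1}(acosK (x := u)) ?in_itv //= ltr_cos ?in_itv //=.
  by rewrite acos_ge0 // acos_lepi.
have hp := rdot_unit_bound x1 y1; have hq := rdot_unit_bound y1 z1.
have /andP[p0 pa] := acos_le _ _ ha hp hxy; have /andP[q0 qb] := acos_le _ _ hb hq hyz.
apply: (@le_trans _ _ (cos (acos (rdot x y) + acos (rdot y z)))).
  have [->//|ne] := eqVneq (a + b) (acos (rdot x y) + acos (rdot y z)).
  have lt : acos (rdot x y) + acos (rdot y z) < a + b.
    by rewrite lt_neqAle eq_sym ne lerD.
  apply: ltW; rewrite ltr_cos ?in_itv //=; first lra.
  by apply/andP; split; lra.
rewrite cosD !acosK ?in_itv // !sin_acos //.
set p := rdot x y; set q := rdot y z.
(* Cauchy-Schwarz for the components of [x] and [z] orthogonal to [y], whose norms are the sines of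
   the two angles. *)
have := rdot_CS (x - p%:C *: y) (z - q%:C *: y).
have -> : l2norm (x - p%:C *: y) = Num.sqrt (1 - p ^+ 2).
  rewrite l2normE !(rdotDl, rdotDr, rdotNl, rdotNr, rdotZl, rdotZr) x1 y1.
  by rewrite (rdotC y x) -/p; congr Num.sqrt; ring.
have -> : l2norm (z - q%:C *: y) = Num.sqrt (1 - q ^+ 2).
  rewrite l2normE !(rdotDl, rdotDr, rdotNl, rdotNr, rdotZl, rdotZr) z1 y1.
  by rewrite (rdotC z y) -/q; congr Num.sqrt; ring.
have -> : rdot (x - p%:C *: y) (z - q%:C *: y) = rdot x z - p * q.
  rewrite !(rdotDl, rdotDr, rdotNl, rdotNr, rdotZl, rdotZr) y1.
  by rewrite -/p -/q; ring.
by rewrite ler_norml => /andP[]; lra.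
Qed.

Lemma unit_vector x : x = 0 \/ exists y (c : R), rdot y y = 1 /\ x = c%:C *: y.
Proof.
have [->|xn0] := eqVneq x 0; [by left|right].
have x0 : 0 < l2norm x.
  rewrite lt_def l2norm_ge0 andbT; apply: contraNneq xn0 => x0.
  by apply/eqP/rdot_eq0; rewrite -l2norm_sqr x0 expr0n.
exists ((l2norm x)^-1%:C *: x), (l2norm x); split.
  by rewrite rdotZl rdotZr -l2norm_sqr mulrA -expr2 -exprMn mulVf ?gt_eqF ?expr1n.
by rewrite scalerA -rmorphM mulfV ?gt_eqF // scale1r.
Qed.

Lemma rdot_unit_suff (c : R) A B : (forall x, rdot x x = 1 -> c <= rdot (A *m x) (B *m x)) ->
  forall x, c * rdot x x <= rdot (A *m x) (B *m x).
Proof.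
move=> h x; have [->|[y [k [y1 ->]]]] := unit_vector x.
  by rewrite !mulmx0 !rdot0r mulr0.
rewrite -!scalemxAr !(rdotZl, rdotZr) y1.
by have := ler_wpM2l (sqr_ge0 k) (h y y1); rewrite expr2; lra.
Qed.

(** The spherical triangle inequality applies to the images of a unit vector [x] under the three
    symmetries. The angles there are doubled, whence [a + b <= pi / 2]. *)
Lemma angle_le_trans a b P Q S : 0 <= a -> 0 <= b -> a + b <= pi / 2 ->
  grassmannian R n P -> grassmannian R n Q -> grassmannian R n S ->
  angle_le a P S -> angle_le b S Q -> angle_le (a + b) P Q.
Proof.
move=> a0 b0 ab hP hQ hS hPS hSQ; have pi0 := @pi_gt0 R.
have sin0 r : 0 <= r -> r <= pi / 2 -> 0 <= sin r.
  by move=> r0 rpi; rewrite sin_ge0_pi // r0; lra.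
apply/angle_leP => //; first by apply: sin0 => //; lra.
move/angle_leP: hPS => /(_ _ hP hS) hPS; move/angle_leP: hSQ => /(_ _ hS hQ) hSQ.
apply: rdot_unit_suff => x x1.
have {}hPS : cos (a *+ 2) <= rdot (refl P *m x) (refl S *m x).
  by have := hPS (sin0 a a0 ltac:(lra)) x; rewrite x1 mulr1.
have {}hSQ : cos (b *+ 2) <= rdot (refl S *m x) (refl Q *m x).
  by have := hSQ (sin0 b b0 ltac:(lra)) x; rewrite x1 mulr1.
rewrite mulrnDl; apply: cosD_le_rdot hPS hSQ; rewrite ?rdot_refl //.
all: rewrite ?mulr2n; try (apply/andP; split); lra.
Qed.

End Angle.

(** * Geodesics and convexity of balls *)

Section Exponential.
Variables (R : realType) (n : nat).
Implicit Types (V : 'M[R[i]]_n) (d : 'I_n -> R).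

Definition cis (x : R) : R[i] := Complex (cos x) (sin x).

Lemma complexE_sum (x y : R) : Complex x y = x%:C + y%:C * Complex 0 1.
Proof. by apply/eqP; rewrite eq_complex /=; apply/andP; split; apply/eqP; ring. Qed.

(** Even powers of [i x] are real and odd ones imaginary, so the exponential series splits termwise
    into those of cosine and sine. *)
Lemma exp_imag (x : R) k : ((k`!%:R : R[i])^-1 * (Complex 0 x) ^+ k) =
  Complex (cos_coeff x k) (sin_coeff x k).
Proof.
have eve m : Complex 0 x ^+ m.*2 = ((-1) ^+ m * x ^+ m.*2)%:C.
  rewrite -mul2n !exprM.
  have -> : Complex 0 x ^+ 2 = (- x ^+ 2)%:C.
    by apply/eqP; rewrite eq_complex /= expr2; apply/andP; split; apply/eqP; ring.
  by rewrite -rmorphXn (exprNn (x ^+ 2)).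
have odde m : Complex 0 x ^+ m.*2.+1 = Complex 0 ((-1) ^+ m * x ^+ m.*2.+1).
  rewrite !(exprS _ m.*2) eve; apply/eqP; rewrite eq_complex /=.
  by apply/andP; split; apply/eqP; ring.
have -> : (k`!%:R : R[i])^-1 = (k`!%:R^-1)%:C by rewrite fmorphV rmorph_nat.
have [m [->|->]] : exists m, k = m.*2.+1 \/ k = m.*2.
  by exists k./2; case: (odd k) (odd_double_half k) => e; [left|right]; rewrite -[LHS]e.
- rewrite /cos_coeff /sin_coeff /= !doubleK odd_double /= odde.
  move: (_ `!%:R^-1 : R) (x ^+ _) ((-1) ^+ m) => a b c.
  by apply/eqP; rewrite eq_complex /=; apply/andP; split; apply/eqP; ring.
- rewrite /cos_coeff /sin_coeff /= !doubleK odd_double /= eve -exprnP.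
  move: (_ `!%:R^-1 : R) (x ^+ _) ((-1) ^+ m) => a b c.
  by apply/eqP; rewrite eq_complex /=; apply/andP; split; apply/eqP; ring.
Qed.

Lemma cvg_real_complex (u : nat -> R) (l : R) : u @ \oo --> l ->
  ((fun k => (u k)%:C) : nat -> (R[i] : numFieldType)) @ \oo --> (l%:C : (R[i] : numFieldType)).
Proof.
(* The tolerance is an element of [R[i]]; being positive, it has zero imaginary part, and its real
   part serves as the real tolerance. *)
move=> /cvgrPdist_lt h; apply/cvgrPdist_lt => -[e f]; rewrite ltcE /= => /andP[/eqP f0 e0].
have := h e e0; apply: filterS => k.
by rewrite -rmorphB normc_def /= expr0n addr0 sqrtr_sqr ltcE /= -f0 eqxx.
Qed.

Lemma cvg_cis (x : R) :
  (series (fun k => (k`!%:R : R[i])^-1 * (Complex 0 x) ^+ k) : nat -> (R[i] : numFieldType))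
  @ \oo --> (cis x : (R[i] : numFieldType)).
Proof.
rewrite /cis complexE_sum.
have -> : series (fun k => (k`!%:R : R[i])^-1 * (Complex 0 x) ^+ k) =
   (fun N => (series (cos_coeff x) N)%:C + (series (sin_coeff x) N)%:C * Complex 0 1).
  apply/funext => N; rewrite /series /= !rmorph_sum mulr_suml -big_split /=.
  by apply: eq_bigr => k _; rewrite exp_imag; exact: complexE_sum.
apply: cvgD; [|apply: cvgMr_tmp]; apply: cvg_real_complex.
  by rewrite cos.unlock; exact: is_cvg_series_cos_coeff.
by rewrite sin.unlock; exact: is_cvg_series_sin_coeff.
Qed.

(** With the diagonal entries split off as scalar coefficients, limits for a fixed [V] reduce to
    limits in [R[i]]. *)
Lemma udiag_sum V w : udiag V w = \sum_j w j *: udiag V (fun k => (k == j)%:R).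
Proof.
apply/matrixP => a b; rewrite summxE unlock mul_mx_diag mxE; apply: eq_bigr => j _.
rewrite mul_mx_diag !mxE (bigD1 j) //= big1 => [|k kj].
  by rewrite !mxE eqxx mulr1 addr0 mulrA [w j * _]mulrC.
by rewrite !mxE (negPf kj) mulr0 mul0r.
Qed.

Lemma udiagX V w k : V \is unitarymx -> udiag V w ^+ k = udiag V (fun j => w j ^+ k).
Proof.
move=> hV; elim: k => [|k IH].
  by rewrite expr0 (_ : (fun j => _) = fun=> 1) ?udiag1 //; apply/funext => j.
rewrite exprS IH [LHS](udiagM _ _ hV); congr udiag; apply/funext => j.
by rewrite exprS.
Qed.

Lemma expmx_udiag V d : V \is unitarymx ->
  expmx (udiag V (fun j => Complex 0 (d j))) = udiag V (fun j => cis (d j)).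
Proof.
move=> hV; rewrite /expmx.
apply: (@cvg_lim 'M[(R[i] : numFieldType)]_n); first exact: norm_hausdorff.
rewrite (udiag_sum V (fun j => cis (d j))).
have -> : series (fun k => (k`!%:R : R[i])^-1 *: udiag V (fun j => Complex 0 (d j)) ^+ k) =
  (fun N => \sum_j series (fun k => (k`!%:R : R[i])^-1 * (Complex 0 (d j)) ^+ k) N
     *: udiag V (fun k => (k == j)%:R)).
  apply/funext => N; rewrite /series /=.
  under [RHS]eq_bigr do rewrite scaler_suml.
  rewrite exchange_big /=; apply: eq_bigr => k _.
  by rewrite udiagX // udiagZ udiag_sum.
apply: cvg_big => [|j _].
  exact: (@pseudometric_normed_Zmodule.add_continuous _ 'M[(R[i] : numFieldType)]_n).
apply: cvgZr_tmp; exact: cvg_cis.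
Qed.

End Exponential.

(** * Trigonometric polynomials and curves *)

Section TrigPoly.
Variables (R : realType) (n : nat).
Implicit Types (k s : R) (a b t : 'I_n -> R).

(** The frequencies [t j] are arbitrary reals and are preserved by differentiation; this closed
    class yields derivatives of all orders by induction. *)
Definition trig_poly k a b t s : R :=
  k + \sum_j (a j * cos (t j * s) + b j * sin (t j * s)).

Lemma is_derive_trig_poly k a b t s : is_derive s 1 (trig_poly k a b t)
  (trig_poly 0 (fun j => t j * b j) (fun j => - (t j * a j)) t s).
Proof.
have is_derive_term (u v w : R) : is_derive s 1 (fun s => u * cos (w * s) + v * sin (w * s))
    (w * v * cos (w * s) - w * u * sin (w * s)).
  have hw : is_derive s 1 (fun s => w * s) w.
    have -> : (fun s => w * s) = w \*: id by [].
    by apply: is_derive_eq (is_deriveZ _ _) _; rewrite /GRing.scale /= mulr1.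
  have hc : is_derive s 1 (fun s => cos (w * s)) (- sin (w * s) * w).
    exact: (is_derive1_comp (g := fun s => w * s)).
  have hs : is_derive s 1 (fun s => sin (w * s)) (cos (w * s) * w).
    exact: (is_derive1_comp (g := fun s => w * s)).
  have := is_deriveD (is_deriveZ u hc) (is_deriveZ v hs).
  by move/is_derive_eq; apply; rewrite /GRing.scale /=; ring.
have := is_deriveD (is_derive_cst k s 1)
  (is_derive_sum (fun j => is_derive_term (a j) (b j) (t j))).
have -> : cst k + \sum_j (fun s => a j * cos (t j * s) + b j * sin (t j * s)) = trig_poly k a b t.
  by apply/funext => x; rewrite /trig_poly [LHS]/GRing.add /= fct_sumE.
by move/is_derive_eq; apply; congr (_ + _); apply: eq_bigr => j _; rewrite mulNr.
Qed.

Lemma derive1_trig_poly k a b t :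
  derive1 (trig_poly k a b t) = trig_poly 0 (fun j => t j * b j) (fun j => - (t j * a j)) t.
Proof.
by apply/funext => s; rewrite derive1E; apply: derive_val; exact: is_derive_trig_poly.
Qed.

Lemma derive1n_trig_poly m k a b t :
  exists k' a' b', derive1n m (trig_poly k a b t) = trig_poly k' a' b' t.
Proof.
elim: m => [|m [k' [a' [b' IH]]]]; first by exists k, a, b.
by rewrite derive1nS IH derive1_trig_poly; do 3 eexists.
Qed.

Lemma derivable_trig_poly k a b t s : derivable (trig_poly k a b t) s 1.
Proof. by case: (is_derive_trig_poly k a b t s). Qed.

Lemma continuous_trig_poly k a b t : continuous (trig_poly k a b t).
Proof.
by move=> s; apply: differentiable_continuous; apply/derivable1_diffP/derivable_trig_poly.
Qed.

End TrigPoly.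

Section TrigCurve.
Variables (R : realType) (n : nat).
Implicit Types (K M V : 'M[R[i]]_n) (t : 'I_n -> R).

(** The shape of a geodesic. Real and imaginary parts of its entries are trigonometric polynomials,
    hence smooth. *)
Definition trig_curve K V M t (s : R) : 'M[R[i]]_n :=
  K + udiag V (fun j => cis (t j * s)) *m M.

Lemma udiag_mulE V w M i k :
  (udiag V w *m M) i k = \sum_j w j * ((V j i)^* * (V *m M) j k).
Proof.
rewrite unlock -(mulmxA _ V M) mul_mx_diag mxE; apply: eq_bigr => j _.
by rewrite !mxE mulrAC mulrC.
Qed.

Lemma Re_trig_curve K V M t i k : (fun s => Re (trig_curve K V M t s i k)) =
  trig_poly (Re (K i k)) (fun j => Re ((V j i)^* * (V *m M) j k))
    (fun j => - Im ((V j i)^* * (V *m M) j k)) t.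
Proof.
apply/funext => s; rewrite /trig_curve mxE udiag_mulE raddfD raddf_sum; congr (_ + _).
apply: eq_bigr => j _; move: (_ * (V *m M) j k) => -[u v] /=; ring.
Qed.

Lemma Im_trig_curve K V M t i k : (fun s => Im (trig_curve K V M t s i k)) =
  trig_poly (Im (K i k)) (fun j => Im ((V j i)^* * (V *m M) j k))
    (fun j => Re ((V j i)^* * (V *m M) j k)) t.
Proof.
apply/funext => s; rewrite /trig_curve mxE udiag_mulE raddfD raddf_sum; congr (_ + _).
apply: eq_bigr => j _; move: (_ * (V *m M) j k) => -[u v] /=; ring.
Qed.

Lemma smooth_trig_curve K V M t : smooth (trig_curve K V M t).
Proof.
move=> i k m x; rewrite Re_trig_curve Im_trig_curve.
split.
  have [k' [a' [b' ->]]] := derive1n_trig_poly m (Re (K i k))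
    (fun j => Re ((V j i)^* * (V *m M) j k)) (fun j => - Im ((V j i)^* * (V *m M) j k)) t.
  exact: derivable_trig_poly.
have [k' [a' [b' ->]]] := derive1n_trig_poly m (Im (K i k))
    (fun j => Im ((V j i)^* * (V *m M) j k)) (fun j => Re ((V j i)^* * (V *m M) j k)) t.
exact: derivable_trig_poly.
Qed.

(** The new diagonal entries are [i t_j e^(i t_j s)], of modulus [|t_j|]. *)
Lemma velocity_trig_curve K V M t s : velocity (trig_curve K V M t) s =
  udiag V (fun j => Complex (- (t j * sin (t j * s))) (t j * cos (t j * s))) *m M.
Proof.
apply/matrixP => i k; rewrite mxE Re_trig_curve Im_trig_curve !derive1_trig_poly.
rewrite udiag_mulE /trig_poly !add0r; apply/eqP; rewrite eq_complex !raddf_sum /=.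
apply/andP; split; apply/eqP; apply: eq_bigr => j _;
  move: (_ * (V *m M) j k) => -[u v] /=; ring.
Qed.

Lemma rdot_udiag_cis V t (y z : 'cV[R[i]]_n) :
  exists a b, forall s, rdot y (udiag V (fun j => cis (t j * s)) *m z) = trig_poly 0 a b t s.
Proof.
exists (fun j => Re (((V *m y) j 0)^* * (V *m z) j 0)),
  (fun j => - Im (((V *m y) j 0)^* * (V *m z) j 0)) => s.
rewrite unlock -!mulmxA rdot_adj trmxCK /rdot raddf_sum /trig_poly add0r.
apply: eq_bigr => j _; rewrite diag_mx_mulE mulrCA.
by move: (_ * (V *m z) j 0) => -[u v] /=; ring.
Qed.

End TrigCurve.

(** * Geodesics in terms of symmetries *)

Section Geodesic.
Variables (R : realType) (n : nat).
Implicit Types (P E X V A : 'M[R[i]]_n) (d : 'I_n -> R).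

(** In the basis given by [V], the entry [(i, j)] of [E] can be nonzero only if [w j = w' i], and
    then [u j = u' i]. An intertwining relation thus passes to functions of the eigenvalues. *)
Lemma udiag_intertwine V E (w w' u u' : 'I_n -> R[i]) : V \is unitarymx ->
  (forall i j, w j = w' i -> u j = u' i) ->
  E *m udiag V w = udiag V w' *m E -> E *m udiag V u = udiag V u' *m E.
Proof.
move=> hV hu; have /unitarymxP VV := hV; have V'V := unitarymxK hV.
have conj_eq (a a' : 'I_n -> R[i]) : E *m udiag V a = udiag V a' *m E <->
    (V *m E *m V ^t*) *m diag_mx (\row_j a j) = diag_mx (\row_j a' j) *m (V *m E *m V ^t*).
  rewrite unlock; split=> h.
    have := congr1 (fun Z => V *m Z *m V ^t*) h.
    by rewrite -!mulmxA VV mulmx1 (mulmxA V (V ^t*)) VV mul1mx !mulmxA.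
  have := congr1 (fun Z => V ^t* *m Z *m V) h.
  by rewrite -!mulmxA V'V mulmx1 (mulmxA (V ^t*) V) V'V mul1mx.
move/conj_eq => h; apply/conj_eq; apply/matrixP => i j.
move/matrixP/(_ i j): h; rewrite !mul_mx_diag !mul_diag_mx !mxE.
move: (\sum_ _ _) => m; have [->|m0] := eqVneq m 0; first by rewrite !mulr0 !mul0r.
by rewrite mulrC => /(mulIf m0) /hu ->; rewrite mulrC.
Qed.

(** For a projection [P] the hypothesis says that [X] is off-diagonal with respect to [P]; it is
    used below in this anticommuting form. *)
Lemma refl_anticommute P X : X = P *m X + X *m P -> refl P *m X = - (X *m refl P).
Proof.
move=> hX; rewrite /refl !(mulmxBl, mulmxBr, mulmxDl, mulmxDr) mul1mx mulmx1.
by apply/eqP; rewrite -subr_eq0 opprK {3 6}hX; apply/eqP/matrixP => i j; rewrite !mxE; ring.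
Qed.

Lemma cisD (a b : R) : cis (a + b) = cis a * cis b.
Proof.
by apply/eqP; rewrite eq_complex /= cosD sinD; apply/andP; split; apply/eqP; ring.
Qed.

Lemma cisN (a : R) : cis (- a) = (cis a)^*.
Proof. by rewrite /cis cosN sinN. Qed.

Section GeodesicDiag.
Variables (P V : 'M[R[i]]_n) (d : 'I_n -> R).
Hypothesis hV : V \is unitarymx.
Hypothesis hX : let X := udiag V (fun j => (d j)%:C) in X = P *m X + X *m P.
Let X := udiag V (fun j => (d j)%:C).

(** Functional calculus for [E X = - X E]: it gives [E u(-X) = u(X) E]. *)
Lemma refl_udiag (u : R -> R[i]) :
  refl P *m udiag V (fun j => u (- d j)) = udiag V (fun j => u (d j)) *m refl P.
Proof.
apply: (udiag_intertwine (w := fun j => (d j)%:C) (w' := fun j => (- d j)%:C)) => //.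
  by move=> i j [->]; rewrite opprK.
rewrite (refl_anticommute hX) -mulNmx; congr (_ *m _).
rewrite -scaleN1r udiagZ; congr udiag; apply/funext => j.
by rewrite mulN1r -rmorphN.
Qed.

Lemma geodesic_curveE s : geodesic_curve P X s =
  udiag V (fun j => cis (d j * s)) *m P *m udiag V (fun j => cis (- (d j * s))).
Proof.
have e : Complex 0 s *: X = udiag V (fun j => Complex 0 (d j * s)).
  rewrite udiagZ; congr udiag; apply/funext => j.
  by apply/eqP; rewrite eq_complex /=; apply/andP; split; apply/eqP; ring.
have e' : - (Complex 0 s *: X) = udiag V (fun j => Complex 0 (- (d j * s))).
  rewrite e -scaleN1r udiagZ; congr udiag; apply/funext => j.
  by apply/eqP; rewrite eq_complex /=; apply/andP; split; apply/eqP; ring.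
by rewrite /geodesic_curve e' e !expmx_udiag.
Qed.

Lemma udiag_cisV s :
  udiag V (fun j => cis (d j * s)) *m udiag V (fun j => cis (- (d j * s))) = 1%:M.
Proof.
rewrite udiagM // -(udiag1 hV); congr udiag; apply/funext => j.
by rewrite -cisD subrr /cis cos0 sin0.
Qed.

(** Moving [e^(-isX)] across the symmetry [E] turns it into [e^(isX)], so
    [e^(isX) E e^(-isX) = e^(2isX) E]. *)
Lemma refl_geodesic s :
  refl (geodesic_curve P X s) = udiag V (fun j => cis (2 * d j * s)) *m refl P.
Proof.
transitivity (udiag V (fun j => cis (d j * s)) *m refl P *m
              udiag V (fun j => cis (- (d j * s)))).
  rewrite geodesic_curveE /refl !(mulmxBr, mulmxBl, mulmxDr, mulmxDl) mulmx1.
  by rewrite udiag_cisV.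
rewrite -mulmxA.
have := refl_udiag (fun x => cis (x * s)).
rewrite (_ : (fun j => cis (- d j * s)) = (fun j => cis (- (d j * s)))); last first.
  by apply/funext => j; rewrite mulNr.
move=> ->; rewrite mulmxA udiagM //; congr (udiag V _ *m _); apply/funext => j.
by rewrite -cisD; congr cis; ring.
Qed.

Lemma grassmannian_geodesic s : grassmannian R n P ->
  grassmannian R n (geodesic_curve P X s).
Proof.
move=> [PP hP]; rewrite geodesic_curveE; set U := udiag V _; set U' := udiag V _.
have UU' : U *m U' = 1%:M by exact: udiag_cisV.
have U'U : U' *m U = 1%:M by exact: mulmx1C.
have UC : U ^t* = U'.
  by rewrite udiagC; congr udiag; apply/funext => j; rewrite cisN.
clearbody U U'.
split; first by rewrite -!mulmxA (mulmxA U' U) U'U mul1mx (mulmxA P P) PP.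
by apply: trmxC_hermsymmx; rewrite !trmxC_mul (hermsymmxC hP) -UC trmxCK mulmxA.
Qed.

(** A projection is half the sum of the identity and its symmetry, so the geodesic is
    [1/2 + e^(2isX) E / 2]. *)
Lemma geodesic_curve_trig : geodesic_curve P X =
  trig_curve ((2^-1 : R)%:C%:M) V ((2^-1 : R)%:C *: refl P) (fun j => 2 * d j).
Proof.
apply/funext => s; rewrite /trig_curve -scalemxAr -refl_geodesic /refl.
move: (geodesic_curve P X s) => A; apply/matrixP => i j; rewrite !mxE.
have h : (2^-1 : R)%:C + (2^-1)%:C = 1 :> R[i].
  by rewrite -rmorphD (_ : 2^-1 + 2^-1 = 1 :> R) ?rmorph1 //; lra.
rewrite -[LHS]mul1r -[X in X * _ = _]h; move: (_%:C) (A i j) => c a.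
by case: (i == j); rewrite ?mulr1n ?mulr0n; ring.
Qed.

End GeodesicDiag.

End Geodesic.

(** * Convexity of balls along geodesics *)

Section BallConvexity.
Variables (R : realType) (n : nat).
Implicit Types (P X V : 'M[R[i]]_n) (d : 'I_n -> R) (C : R -> Prop).

(** Bisection: an interval around [s] with both ends in [C] is halved [k] times. *)
Lemma midpoint_dense C (s : R) (k : nat) : C 0 -> C 1 ->
  (forall a b, 0 <= a -> a <= b -> b <= 1 -> C a -> C b -> C ((a + b) / 2)) ->
  0 <= s <= 1 -> exists2 a, C a & `|s - a| <= 2^-1 ^+ k.
Proof.
move=> C0 C1 Cm hs.
suff [a [b [Ca [Cb h]]]] : exists a b, C a /\ C b /\
    [/\ 0 <= a, a <= s, s <= b, b <= 1 & b - a = 2^-1 ^+ k].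
  by exists a => //; case: h => a0 as_ sb b1 <-; rewrite ger0_norm; lra.
elim: k => [|k [a [b [Ca [Cb [a0 as_ sb b1 e]]]]]].
  by exists 0, 1; split=> //; split=> //; split; rewrite ?expr0; lra.
have Cab := Cm _ _ a0 (le_trans as_ sb) b1 Ca Cb.
have [h|h] := leP s ((a + b) / 2).
  by exists a, ((a + b) / 2); split=> //; split=> //; split; rewrite ?exprS -?e; lra.
by exists ((a + b) / 2), b; split=> //; split=> //; split; rewrite ?exprS -?e; lra.
Qed.

(** A failure at [s] would persist near [s], against the density of good points obtained by
    bisection. The inequalities form a family because one of them at a midpoint may depend on
    several others at the ends. *)
Lemma midpoint_le_continuous I (f : I -> R -> R) (g : I -> R) (s : R) :
  (forall i, continuous (f i)) ->
  (forall i, g i <= f i 0) -> (forall i, g i <= f i 1) ->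
  (forall a b, 0 <= a -> a <= b -> b <= 1 -> (forall i, g i <= f i a) ->
    (forall i, g i <= f i b) -> forall i, g i <= f i ((a + b) / 2)) ->
  0 <= s <= 1 -> forall i, g i <= f i s.
Proof.
move=> fc f0 f1 fm hs i; rewrite leNgt; apply/negP => lt.
have := fc i s; move/cvgrPdist_lt => /(_ (g i - f i s)); rewrite subr_gt0 => /(_ lt).
case=> e /= e0 he.
have [k hk] : exists k, (2^-1 : R) ^+ k < e.
  have : (fun k => (2^-1 : R) ^+ k) @ \oo --> (0 : R).
    by apply: cvg_expr; rewrite ger0_norm ?invr_ge0 // invf_lt1 // ltr1n.
  move=> /cvgrPdist_lt /(_ e e0) [k _ /(_ k (leqnn k))].
  by rewrite /= sub0r normrN ger0_norm ?exprn_ge0 ?invr_ge0 // => h; exists k.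
have [a Ca ha] := midpoint_dense k f0 f1 fm hs.
have := he a (le_lt_trans ha hk); have := Ca i.
by rewrite /= ltr_norml; lra.
Qed.

Lemma cos_gt0_lt_pi (x : R) : `|x| < pi / 2 -> 0 < cos x.
Proof. by rewrite ltr_norml => h; apply: cos_gt0_pihalf. Qed.

Lemma udiag_ball_convex V d P Q (r s : R) : V \is unitarymx ->
  let X := udiag V (fun j => (d j)%:C) in
  X = P *m X + X *m P -> (forall j, `|d j| < pi / 2) ->
  grassmannian R n P -> grassmannian R n Q -> 0 <= r < pi / 4 -> 0 <= s <= 1 ->
  angle_le r Q (geodesic_curve P X 0) -> angle_le r Q (geodesic_curve P X 1) ->
  angle_le r Q (geodesic_curve P X s).
Proof.
move=> hV X hX hd hP hQ hr hs; have pi0 := @pi_gt0 R.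
have r0 : 0 <= sin r by apply: sin_ge0_pi; apply/andP; split; lra.
(* This positivity is what [r < pi / 4] is for. *)
have c0 : 0 < cos (r *+ 2).
  by apply: cos_gt0_lt_pi; rewrite ger0_norm mulr2n; lra.
have hG a := grassmannian_geodesic d hV a hP.
(* The symmetry of the point of the geodesic at time [a]. *)
pose S a := udiag V (fun j => cis (2 * d j * a)) *m refl P.
have hSh a : S a \is hermsymmx by rewrite /S -(refl_geodesic hV hX); exact: hermsymmx_refl.
have SK a : S a *m S a = 1%:M by rewrite /S -(refl_geodesic hV hX); exact: reflK.
have hSle a : angle_le r Q (geodesic_curve P X a) <->
    forall x, cos (r *+ 2) * rdot x x <= rdot (refl Q *m x) (S a *m x).
  rewrite /S -(refl_geodesic hV hX); exact: angle_leP.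
move=> /hSle h0 /hSle h1; apply/hSle.
(* The family is indexed by the vectors [x]; it remains to prove continuity in time and the midpoint
   step. *)
apply: (@midpoint_le_continuous _ (fun x s => rdot (refl Q *m x) (S s *m x))
  (fun x => cos (r *+ 2) * rdot x x) _ _ h0 h1 _ hs) => [x|a b a0 ab b1 ha hb].
  have [a' [b' e]] := rdot_udiag_cis V (fun j => 2 * d j) (refl Q *m x) (refl P *m x).
  have -> : (fun s => rdot (refl Q *m x) (S s *m x)) =
      trig_poly 0 a' b' (fun j => 2 * d j).
    by apply/funext => s'; rewrite /S -mulmxA e.
  exact: continuous_trig_poly.
(* [B = 2 cos ((b - a) X)]; being an even function of [X], it commutes with the symmetry. *)
pose B := udiag V (fun j => (2 * cos ((b - a) * d j))%:C).
have BP : refl P *m B = B *m refl P.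
  rewrite -(refl_udiag hV hX (fun x => (2 * cos ((b - a) * x))%:C)).
  by congr (_ *m udiag _ _); apply/funext => j; rewrite mulrN cosN.
apply: (anticommutator_lower_bound (B := B) _ _ _ c0 _ _ _ ha hb).
- exact: hermsymmx_refl.
- exact: hSh.
- exact: SK.
(* On eigenvalues this is [cis (u - v) + cis (u + v) = 2 cos v cis u]. *)
- rewrite /S -mulmxA BP mulmxA -mulmxDl udiagD /B udiagM //.
  congr (udiag V _ *m _); apply/funext => j.
  have -> : 2 * d j * a = 2 * d j * ((a + b) / 2) - (b - a) * d j by field.
  have -> : 2 * d j * b = 2 * d j * ((a + b) / 2) + (b - a) * d j by field.
  move: (2 * d j * _) ((b - a) * d j) => u v; rewrite !cisD cisN.
  by apply/eqP; rewrite eq_complex /=; apply/andP; split; apply/eqP; ring.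
- rewrite /S mulmxA -(mulmxA _ (refl P)) BP mulmxA /B !udiagM //.
  by congr (udiag V _ *m _); apply/funext => j; rewrite mulrC.
(* From [0 <= b - a <= 1] and [|d j| < pi / 2] the cosines are positive, so [0 <= B <= 2]. *)
- move=> x; rewrite rdot_udiag (rdot_sqrn_unitary x hV) mulr_sumr.
  have cj j : 0 < cos ((b - a) * d j).
    apply: cos_gt0_lt_pi; rewrite normrM; apply: le_lt_trans (hd j).
    by rewrite -[leRHS]mul1r ler_wpM2r // ger0_norm; lra.
  apply/andP; split.
    by apply: sumr_ge0 => j _; rewrite !mulr_ge0 ?sqrn_ge0 // ltW.
  apply: ler_sum => j _; rewrite ler_wpM2r ?sqrn_ge0 //.
  by have := cos_le1 ((b - a) * d j); lra.
Qed.

Lemma spectral_norm_udiag_ge V d j : V \is unitarymx ->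
  `|d j| <= spectral_norm (udiag V (fun j => (d j)%:C)).
Proof.
move=> hV; have := l2norm_mulmx_le (udiag V (fun j => (d j)%:C)) (udiag_vec V j).
rewrite udiag_vecE // l2normZ.
have -> : l2norm (udiag_vec V j) = 1 by rewrite l2normE rdot_udiag_vec // sqrtr1.
by rewrite !mulr1.
Qed.

Lemma geodesic_curve0 P X : X \is hermsymmx -> X = P *m X + X *m P ->
  geodesic_curve P X 0 = P.
Proof.
move=> /hermsymmx_udiag [V [d [hV ->]]] hX; rewrite (geodesic_curveE _ _ hV).
rewrite (_ : (fun j => _) = fun=> 1); last first.
  by apply/funext => j; rewrite mulr0 /cis cos0 sin0.
rewrite (_ : (fun j => cis (- _)) = fun=> 1); last first.
  by apply/funext => j; rewrite mulr0 oppr0 /cis cos0 sin0.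
by rewrite udiag1 // mulmx1 mul1mx.
Qed.

Lemma ball_geodesic_convex P P' Q X (r s : R) : geodesic_generator P P' X ->
  grassmannian R n P -> grassmannian R n Q -> 0 <= r < pi / 4 -> 0 <= s <= 1 ->
  angle_le r Q P -> angle_le r Q P' ->
  grassmannian R n (geodesic_curve P X s) /\ angle_le r Q (geodesic_curve P X s).
Proof.
move=> [hXh hX hXn hP'] hP hQ hr hs h0 h1.
have e1 : geodesic_curve P X 1 = P' by rewrite hP'.
have e0 := geodesic_curve0 hXh hX.
have [V [d [hV eX]]] := hermsymmx_udiag hXh.
rewrite eX in hX hXn e0 e1 *; split; first exact: grassmannian_geodesic.
rewrite -e1 in h1; rewrite -[in angle_le r Q P]e0 in h0.
apply: (udiag_ball_convex hV hX _ hP hQ hr hs h0 h1) => j.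
exact: le_lt_trans (spectral_norm_udiag_ge d j hV) hXn.
Qed.

End BallConvexity.

(** * Existence of geodesics *)

Section GeodesicExistence.
Variables (R : realType) (n : nat).
Implicit Types (P Q X V : 'M[R[i]]_n) (d : 'I_n -> R) (w : 'I_n -> R[i]).

Lemma udiag_eq1 V w j : V \is unitarymx -> udiag V w = 1%:M -> w j = 1.
Proof.
move=> hV e; have := udiag_vecE w j hV; rewrite e mul1mx -{1}[udiag_vec V j]scale1r.
move=> /eqP; rewrite -subr_eq0 -scalerBl scaler_eq0 => /orP[|/eqP v0].
  by rewrite subr_eq0 => /eqP.
by have /eqP := rdot_udiag_vec j hV; rewrite v0 rdot0r eq_sym oner_eq0.
Qed.

(** Half the argument of a point of the unit circle other than [-1]. The sign vanishes on the real
    axis, so conjugation changes the sign without exception; the resulting value [0] at [-1] is a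
    default. *)
Definition half_arg (z : R[i]) : R := Num.sg (Im z) * acos (Re z) / 2.

Lemma half_argC z : half_arg z^* = - half_arg z.
Proof. by case: z => a b; rewrite /half_arg /= sgrN !mulNr. Qed.

Lemma half_argP (z : R[i]) (r : R) : 0 <= r < pi / 2 -> z * z^* = 1 -> cos (r *+ 2) <= Re z ->
  `|half_arg z| <= r /\ cis (2 * half_arg z) = z.
Proof.
case: z => a b hr; have pi0 := @pi_gt0 R.
move=> /eqP; rewrite eq_complex /= => /andP[/eqP ab _] ha.
have {}ab : a ^+ 2 + b ^+ 2 = 1 by rewrite -ab; ring.
have a1 : -1 <= a <= 1.
  rewrite -ler_norml -(ler_pXn2r (n:=2)) ?nnegrE // real_normK ?num_real //.
  by rewrite expr1n -ab lerDl sqr_ge0.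
have c1 : -1 < cos (r *+ 2).
  by rewrite -(@cospi R) ltr_cos ?in_itv /= ?mulr2n; try (apply/andP; split); lra.
have ac : acos a <= r *+ 2.
  rewrite leNgt; apply/negP => lt_c; move: ha; rewrite leNgt => /negP; apply.
  rewrite -{1}(acosK (x := a)) ?in_itv //= ltr_cos ?in_itv //=.
    by rewrite mulr2n; apply/andP; split; lra.
  by rewrite acos_ge0 // acos_lepi.
have ac0 := acos_ge0 a1.
have -> : 2 * half_arg (Complex a b) = Num.sg b * acos a by rewrite /half_arg /=; field.
(* A real [z] is [1] or [-1], and [-1] is excluded by [cos (2 r) > -1]. *)
have [b0|bn0] := eqVneq b 0.
  have a_eq : a = 1.
    have : (a - 1) * (a + 1) = 0.
      by rewrite -subr_sqr expr1n -ab b0 expr0n addr0 subrr.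
    move/eqP; rewrite mulf_eq0 subr_eq0 addr_eq0 => /orP[/eqP//|/eqP h].
    by move: ha; rewrite h => /(lt_le_trans c1); rewrite ltxx.
  rewrite /half_arg /= b0 a_eq sgr0 !mul0r normr0; split; first by case/andP: hr.
  by rewrite /cis cos0 sin0.
split.
  rewrite /half_arg /= !normrM normr_sg bn0 mul1r (ger0_norm ac0) ger0_norm ?invr_ge0 //.
  by move: ac; rewrite mulr2n; lra.
rewrite /cis cos_sg // sin_sg acosK ?in_itv // sin_acos //; congr Complex.
have -> : 1 - a ^+ 2 = b ^+ 2 by rewrite -ab; ring.
by rewrite sqrtr_sqr [RHS]numEsg.
Qed.

Lemma addrr_inj (x y : R[i]) : x + x = y + y -> x = y.
Proof.
case: x y => [a b] [c d] /eqP; rewrite eq_complex /= => /andP[/eqP h1 /eqP h2].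
by congr Complex; lra.
Qed.

Lemma refl_inj P Q : refl P = refl Q -> P = Q.
Proof.
move=> /matrixP h; apply/matrixP => i j; have := h i j; rewrite !mxE => /addIr.
exact: addrr_inj.
Qed.

Lemma rdotZ_self (z : R[i]) (x : 'cV[R[i]]_n) : rdot (z *: x) x = Re z * rdot x x.
Proof.
rewrite !rdotE mulr_sumr; apply: eq_bigr => i _; rewrite mxE.
by case: z (x i 0) => [a b] [u v] /=; ring.
Qed.

Lemma anticommute_refl P X : refl P *m X = - (X *m refl P) -> X = P *m X + X *m P.
Proof.
move=> h; have {}h : (P *m X + X *m P) + (P *m X + X *m P) = X + X.
  move/eqP: h; rewrite -subr_eq0 opprK /refl.
  rewrite !(mulmxBl, mulmxBr, mulmxDl, mulmxDr) mul1mx mulmx1 => /eqP/matrixP h.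
  apply/matrixP => i j; have := h i j; rewrite !mxE.
  move: (\sum_ _ _) (\sum_ _ _) (X i j) => a b c /eqP.
  rewrite -subr_eq0 subr0 => /eqP e; apply/eqP; rewrite -subr_eq0 -e; apply/eqP; ring.
apply/matrixP => i j; move/matrixP/(_ i j): h; rewrite [LHS]mxE [RHS]mxE => e.
by apply/addrr_inj.
Qed.

(** With [E] and [F] the symmetries of [P] and [Q], the unitary [W = F E] is diagonalized, and [X]
    has the half arguments of its eigenvalues. Then [e^(2iX) = W], so the geodesic ends at the
    symmetry [W E = F]. *)
Lemma geodesic_exists P Q (r : R) : grassmannian R n P -> grassmannian R n Q ->
  0 <= r < pi / 2 -> angle_le r P Q ->
  exists V d, let X := udiag V (fun j => (d j)%:C) in
    [/\ V \is unitarymx, forall j, `|d j| <= r, X = P *m X + X *m P &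
        Q = geodesic_curve P X 1].
Proof.
move=> hP hQ hr hPQ; have pi0 := @pi_gt0 R.
have r0 : 0 <= sin r by apply: sin_ge0_pi; apply/andP; split; lra.
have hE := hermsymmxC (hermsymmx_refl hP); have hF := hermsymmxC (hermsymmx_refl hQ).
have EE := reflK hP; have FF := reflK hQ.
pose W := refl Q *m refl P.
have WC : W ^t* = refl P *m refl Q by rewrite trmxC_mul hE hF.
have WW : W *m W ^t* = 1%:M by rewrite WC /W -mulmxA (mulmxA (refl P)) EE mul1mx FF.
have WW' : W ^t* *m W = 1%:M by rewrite WC /W -mulmxA (mulmxA (refl Q)) FF mul1mx EE.
have [V [w [hV eW]]] : exists V w, V \is unitarymx /\ W = udiag V w.
  by apply: normal_udiag; apply/normalmxP; rewrite WW WW'.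
have ww j : w j * (w j)^* = 1.
  apply: (udiag_eq1 (w := fun j => w j * (w j)^*) j hV).
  by rewrite -udiagM // -udiagC -eW.
(* For a unit eigenvector [v] of [W] one has [E v = w_j F v], so [<E v, F v>] is the real part of
   [w_j]. *)
have wr j : cos (r *+ 2) <= Re (w j).
  have := (angle_leP r0 hP hQ).1 hPQ (udiag_vec V j).
  have -> : refl P *m udiag_vec V j = w j *: (refl Q *m udiag_vec V j).
    by rewrite scalemxAr -(udiag_vecE _ _ hV) -eW /W !mulmxA FF mul1mx.
  by rewrite rdotZ_self rdot_refl // rdot_udiag_vec // !mulr1.
have hw j := half_argP hr (ww j) (wr j).
exists V, (fun j => half_arg (w j)) => X.
have hX : X = P *m X + X *m P.
  apply: anticommute_refl; rewrite -mulNmx.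
  have -> : - X = udiag V (fun j => (- half_arg (w j))%:C).
    rewrite -scaleN1r udiagZ; congr udiag; apply/funext => j.
    by rewrite mulN1r -rmorphN.
  (* [E W = W^* E], and half arguments change sign under conjugation; hence [E X = - X E]. *)
  apply: (udiag_intertwine (w := w) (w' := fun j => (w j)^*) hV).
    by move=> i j ->; rewrite half_argC.
  by rewrite -udiagC -eW WC /W mulmxA.
split=> //; first by move=> j; case: (hw j).
apply: refl_inj; rewrite (refl_geodesic hV hX).
rewrite (_ : (fun j => _) = w); last by apply/funext => j; rewrite mulr1; case: (hw j).
by rewrite -eW /W -mulmxA EE mulmx1.
Qed.

End GeodesicExistence.

(** * Length of curves *)

Section SpeedContinuity.
Variables (R : realType) (n : nat).
Implicit Types (g delta : R -> 'M[R[i]]_n).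

Lemma Re_velocity delta t i j : Re (velocity delta t i j) = derive1 (fun s => Re (delta s i j)) t.
Proof. by rewrite mxE. Qed.

Lemma Im_velocity delta t i j : Im (velocity delta t i j) = derive1 (fun s => Im (delta s i j)) t.
Proof. by rewrite mxE. Qed.

Lemma derivable_continuous (f : R -> R) : (forall x, derivable f x 1) -> continuous f.
Proof. by move=> h x; apply: differentiable_continuous; apply/derivable1_diffP. Qed.

Lemma continuous_Re_velocity g i j : smooth g -> continuous (fun t => Re (velocity g t i j)).
Proof.
move=> hg; rewrite (_ : (fun t => _) = derive1n 1 (fun s => Re (g s i j))).
  by apply: derivable_continuous => x; exact: (hg i j 1%N x).1.
by apply/funext => t; rewrite Re_velocity derive1nS derive1n0.
Qed.

Lemma continuous_Im_velocity g i j : smooth g -> continuous (fun t => Im (velocity g t i j)).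
Proof.
move=> hg; rewrite (_ : (fun t => _) = derive1n 1 (fun s => Im (g s i j))).
  by apply: derivable_continuous => x; exact: (hg i j 1%N x).2.
by apply/funext => t; rewrite Im_velocity derive1nS derive1n0.
Qed.

Lemma continuous_spectral_norm (A : R -> 'M[R[i]]_n) :
  (forall i j, continuous (fun t => Re (A t i j))) ->
  (forall i j, continuous (fun t => Im (A t i j))) ->
  continuous (fun t => spectral_norm (A t)).
Proof.
move=> hRe hIm t; apply/cvgrPdist_le => e e0.
have h0 : (fun s => 2 * entry_sum (A t - A s)) @ t --> (0 : R).
  have -> : (0 : R) = 2 * \sum_(i < n) \sum_(j < n) (`|Re (A t i j) - Re (A t i j)| +
      `|Im (A t i j) - Im (A t i j)|).
    rewrite big1 ?mulr0 // => i _; rewrite big1 // => j _.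
    by rewrite !subrr normr0 addr0.
  apply: cvgMl_tmp.
  rewrite /entry_sum; apply: cvg_big => [|i _]; first exact: add_continuous.
  apply: cvg_big => [|j _]; first exact: add_continuous.
  apply: cvgD; apply: cvg_norm.
    rewrite (_ : (fun s => _) = (fun s => Re (A t i j) - Re (A s i j))).
      by apply: cvgB; [exact: cvg_cst|exact: hRe].
    by apply/funext => s; rewrite !mxE raddfB.
  rewrite (_ : (fun s => _) = (fun s => Im (A t i j) - Im (A s i j))).
    by apply: cvgB; [exact: cvg_cst|exact: hIm].
  by apply/funext => s; rewrite !mxE raddfB.
move/cvgrPdist_le: h0 => /(_ e e0); apply: filterS => s.
rewrite sub0r normrN => h; apply: le_trans (spectral_norm_dist _ _) _.
exact: le_trans (ler_norm _) h.
Qed.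

Lemma continuous_speed g : smooth g -> continuous (fun t => spectral_norm (velocity g t)).
Proof.
move=> hg; apply: continuous_spectral_norm => i j.
  exact: continuous_Re_velocity.
exact: continuous_Im_velocity.
Qed.

End SpeedContinuity.

(** * The angle bounds the distance from above *)

Section UpperBound.
Variables (R : realType) (n : nat).
Implicit Types (P Q X V : 'M[R[i]]_n).

Lemma curve_length_smooth_le (g : R -> 'M[R[i]]_n) (r : R) : smooth g ->
  (forall t, spectral_norm (velocity g t) <= r) -> (curve_length g <= r%:E)%E.
Proof.
move=> hg hr; rewrite /curve_length.
have -> : r%:E = (\int[@lebesgue_measure R]_(t in `[0%R, 1%R]) (cst r%:E) t)%E.
  by rewrite integral_cst //= lebesgue_measure_itv /= lte01 oppr0 adde0 mule1.
apply: ge0_le_integral => //.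
- by move=> t _; rewrite lee_fin spectral_norm_ge0.
- apply/measurable_EFinP; apply: measurable_funTS.
  by apply: continuous_measurable_fun; exact: continuous_speed.
- by move=> t _; rewrite lee_fin.
Qed.

(** The geodesic from [P] to [Q] is an admissible curve of speed at most [r]. *)
Lemma angle_le_dist P Q (r : R) : grassmannian R n P -> grassmannian R n Q ->
  0 <= r < pi / 2 -> angle_le r P Q -> (dist_infty P Q <= r%:E)%E.
Proof.
move=> hP hQ hr /(geodesic_exists hP hQ hr) [V [d [hV hd hX hPQ]]].
set X := udiag V _ in hX hPQ.
have e0 : geodesic_curve P X 0 = P.
  apply: geodesic_curve0 hX.
  apply: trmxC_hermsymmx; rewrite udiagC; congr udiag; apply/funext => j.
  exact: conjc_real.
have hg x : grassmannian R n (geodesic_curve P X x) by exact: grassmannian_geodesic.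
move: (geodesic_curve_trig hV hX) hPQ e0 hg.
move: (geodesic_curve P X) => g eg hPQ e0 hg.
apply: (@le_trans _ _ (curve_length g)).
  apply: ereal_inf_lbound; exists g; last exact: erefl.
  split; [|by move=> x _; exact: hg|exact: e0|exact/esym].
  exists [:: 1]; split; first by split; rewrite //= ltr01.
  move=> k _; exists g; split; last by move=> x _; exact: erefl.
  by rewrite eg; exact: smooth_trig_curve.
rewrite eg; apply: curve_length_smooth_le; first exact: smooth_trig_curve.
move=> t; rewrite velocity_trig_curve; case/andP: hr => r0 _.
apply: spectral_norm_le => // x; rewrite -mulmxA -scalemxAl.
apply: (@le_trans _ _ (2 * r * l2norm ((2^-1 : R)%:C *: (refl P *m x)))).
  apply: l2norm_udiag_le; rewrite ?mulr_ge0 // => j /=.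
  move: (_ * t) => u; have -> : (- (2 * d j * sin u)) ^+ 2 + (2 * d j * cos u) ^+ 2 =
    4 * d j ^+ 2 * (cos u ^+ 2 + sin u ^+ 2) by ring.
  rewrite cos2Dsin2 mulr1 exprMn (_ : 2 ^+ 2 = 4); last by rewrite expr2; lra.
  rewrite ler_wpM2l // -(real_normK (num_real (d j))) ler_pXn2r ?nnegrE //.
rewrite l2normZ ger0_norm ?invr_ge0 // !l2normE rdot_refl //.
by rewrite le_eqVlt; apply/orP; left; apply/eqP; field.
Qed.

End UpperBound.

Section LowerBound.
Variables (R : realType) (n : nat).
Implicit Types (P Q A : 'M[R[i]]_n) (x y : 'cV[R[i]]_n) (g delta : R -> 'M[R[i]]_n).

Lemma rdot_mulmxE y A x : rdot y (A *m x) = \sum_i \sum_j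
  (Re ((y i 0)^* * x j 0) * Re (A i j) + - Im ((y i 0)^* * x j 0) * Im (A i j)).
Proof.
rewrite /rdot raddf_sum; apply: eq_bigr => i _.
rewrite mxE mulr_sumr raddf_sum; apply: eq_bigr => j _.
by case: (y i 0) (x j 0) (A i j) => [a b] [c d] [u v] /=; ring.
Qed.

Lemma is_derive_rdot g y x (t : R) : smooth g ->
  is_derive t 1 (fun s => rdot y (g s *m x)) (rdot y (velocity g t *m x)).
Proof.
move=> hg.
have hij i j : is_derive t 1
    (fun s => Re ((y i 0)^* * x j 0) * Re (g s i j) + - Im ((y i 0)^* * x j 0) * Im (g s i j))
    (Re ((y i 0)^* * x j 0) * Re (velocity g t i j) +
       - Im ((y i 0)^* * x j 0) * Im (velocity g t i j)).
  rewrite Re_velocity Im_velocity !derive1E.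
  have hRe : is_derive t 1 (fun s => Re (g s i j)) ('D_1 (fun s => Re (g s i j)) t).
    by apply: derivableP; exact: (hg i j 0%N t).1.
  have hIm : is_derive t 1 (fun s => Im (g s i j)) ('D_1 (fun s => Im (g s i j)) t).
    by apply: derivableP; exact: (hg i j 0%N t).2.
  exact: is_deriveD (is_deriveZ _ hRe) (is_deriveZ _ hIm).
have := is_derive_sum (fun i => is_derive_sum (fun j => hij i j)).
rewrite rdot_mulmxE; congr (is_derive _ _ _ _); apply/funext => s.
by rewrite rdot_mulmxE fct_sumE; apply: eq_bigr => i _; rewrite fct_sumE.
Qed.

Lemma rdot_refl_linear y A x : rdot y (refl A *m x) = 2 * rdot y (A *m x) - rdot y x.
Proof.
by rewrite /refl mulmxBl mulmxDl mul1mx rdotDr rdotNr rdotDr; ring.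
Qed.

Lemma is_derive_rdot_refl g y x (t : R) : smooth g ->
  is_derive t 1 (fun s => rdot y (refl (g s) *m x)) (2 * rdot y (velocity g t *m x)).
Proof.
move=> hg.
have := is_deriveD (is_deriveZ 2 (is_derive_rdot y x t hg)) (is_derive_cst (- rdot y x) t 1).
rewrite addr0; congr (is_derive _ _ _ _); apply/funext => s.
by rewrite rdot_refl_linear.
Qed.

Lemma continuous_rdot_velocity g y x : smooth g ->
  continuous (fun s => rdot y (velocity g s *m x)).
Proof.
move=> hg t; rewrite /continuous_at rdot_mulmxE.
rewrite (_ : (fun s => _) = fun s => \sum_i \sum_j
  (Re ((y i 0)^* * x j 0) * Re (velocity g s i j) +
   - Im ((y i 0)^* * x j 0) * Im (velocity g s i j))); last first.
  by apply/funext => s; rewrite rdot_mulmxE.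
apply: cvg_big => [|i _]; first exact: add_continuous.
apply: cvg_big => [|j _]; first exact: add_continuous.
apply: cvgD; apply: cvgMl_tmp; [exact: continuous_Re_velocity|exact: continuous_Im_velocity].
Qed.

(* The squared norm of [refl (g s) x] being constant, the inner product with
   [refl (g t) x] is maximal at [s = t]. *)
Lemma rdot_velocity0 g x (a b t : R) : smooth g ->
  (forall s, a <= s <= b -> grassmannian R n (g s)) -> a < t < b ->
  rdot (refl (g t) *m x) (velocity g t *m x) = 0.
Proof.
move=> hg hG /andP[at_ tb].
have Gt : grassmannian R n (g t) by apply: hG; lra.
have d s := is_derive_rdot_refl (refl (g t) *m x) x s hg.
have d0 : is_derive t 1 (fun s => rdot (refl (g t) *m x) (refl (g s) *m x)) 0.
  apply: (@derive1_at_max _ _ a b) => [|s _||s]; rewrite ?in_itv /=; first lra.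
  - by case: (d s).
  - by rewrite at_ tb.
  move=> hs; have Gs : grassmannian R n (g s) by apply: hG; lra.
  apply: le_trans (ler_norm _) _; apply: le_trans (rdot_CS _ _) _.
  by rewrite !l2normE !rdot_refl // -expr2 sqr_sqrtr ?rdot_ge0.
have := @derive_val _ _ _ _ _ _ _ (d t); rewrite (@derive_val _ _ _ _ _ _ _ d0).
by move=> /esym/eqP; rewrite mulf_eq0 pnatr_eq0 => /eqP.
Qed.

Lemma rdot_velocity_bound g x y (a b t k : R) : smooth g -> rdot x x = 1 -> rdot y y = 1 ->
  (forall s, a <= s <= b -> grassmannian R n (g s)) -> a < t < b -> 0 < k < 1 ->
  `|k * rdot y (velocity g t *m x)| / Num.sqrt (1 - (k * rdot y (refl (g t) *m x)) ^+ 2)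
   <= spectral_norm (velocity g t).
Proof.
move=> hg x1 y1 hG hab hk.
have v0 := rdot_velocity0 x hg hG hab.
have Gt : grassmannian R n (g t) by apply: hG; case/andP: hab => *; lra.
have u1 : rdot (refl (g t) *m x) (refl (g t) *m x) = 1 by rewrite rdot_refl.
have := rdot_unit_bound y1 u1.
set u := refl (g t) *m x in v0 u1 *; set v := velocity g t *m x in v0 *; set f := rdot y u => hf.
have -> : rdot y v = rdot (y - f%:C *: u) v.
  by rewrite rdotDl rdotNl rdotZl v0 mulr0 subr0.
have f1 : f ^+ 2 <= 1.
  have : `|f| <= 1 by rewrite ler_norml.
  by rewrite -(ler_pXn2r (n:=2)) ?nnegrE // real_normK ?num_real // expr1n.
have k2 : 0 <= k ^+ 2 < 1.
  by rewrite sqr_ge0 expr_lt1 //; case/andP: hk => /ltW.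
have s0 : 0 < 1 - (k * f) ^+ 2.
  rewrite exprMn subr_gt0; case/andP: k2 => k20 k21.
  by apply: le_lt_trans k21; rewrite -[leRHS]mulr1 ler_wpM2l.
rewrite ler_pdivrMr ?sqrtr_gt0 // normrM ger0_norm; last by case/andP: hk => /ltW.
have hCS := rdot_CS (y - f%:C *: u) v.
have e1 : l2norm (y - f%:C *: u) = Num.sqrt (1 - f ^+ 2).
  rewrite l2normE !(rdotDl, rdotDr, rdotNl, rdotNr, rdotZl, rdotZr) y1 u1.
  by rewrite (rdotC u y) -/f; congr Num.sqrt; ring.
rewrite e1 in hCS.
have k0 : 0 <= k by case/andP: hk => /ltW.
apply: le_trans (ler_wpM2l k0 hCS) _.
have hv : l2norm v <= spectral_norm (velocity g t).
  apply: le_trans (l2norm_mulmx_le _ _) _.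
  by rewrite (l2normE x) x1 sqrtr1 mulr1.
rewrite mulrA mulrC; apply: ler_pM; rewrite ?l2norm_ge0 ?mulr_ge0 ?sqrtr_ge0 //.
rewrite -(ler_pXn2r (n:=2)) ?nnegrE ?mulr_ge0 ?sqrtr_ge0 // exprMn.
rewrite (sqr_sqrtr (ltW s0)) sqr_sqrtr ?subr_ge0 //.
by rewrite exprMn; case/andP: k2 => _ /ltW; lra.
Qed.

End LowerBound.

Section PieceLowerBound.
Variables (R : realType) (n : nat).
Implicit Types (x y : 'cV[R[i]]_n) (g : R -> 'M[R[i]]_n).

(* The factor [k < 1] keeps [asin] away from its singularities at [1] and [-1]. *)
Lemma asin_variation_le g x y (a b k : R) : smooth g -> rdot x x = 1 -> rdot y y = 1 ->
  a < b -> (forall s, a <= s <= b -> grassmannian R n (g s)) -> 0 < k < 1 ->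
  (((asin (k * rdot y (refl (g a) *m x)) - asin (k * rdot y (refl (g b) *m x))) / 2)%:E <=
   \int[@lebesgue_measure R]_(t in `]a, b[) (spectral_norm (velocity g t))%:E)%E.
Proof.
move=> hg x1 y1 ab hG hk.
pose f s := k * rdot y (refl (g s) *m x).
pose D s := - (k * rdot y (velocity g s *m x) / Num.sqrt (1 - f s ^+ 2)).
pose F s := - (asin (f s) / 2).
have f1 s : a <= s <= b -> -1 < f s < 1.
  move=> hs; have Gs := hG s hs.
  have u1 : rdot (refl (g s) *m x) (refl (g s) *m x) = 1 by rewrite rdot_refl.
  have := rdot_unit_bound y1 u1; rewrite -!ltr_norml -!ler_norml => h.
  case/andP: hk => k0 k1; rewrite /f normrM (gtr0_norm k0).
  by apply: le_lt_trans k1; rewrite -[leRHS]mulr1 ler_wpM2l // ltW.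
have sq0 s : a <= s <= b -> 0 < 1 - f s ^+ 2.
  move=> /f1; rewrite -ltr_norml => h.
  by rewrite subr_gt0 -(real_normK (num_real (f s))) expr_lt1.
have df (s : R) : is_derive s 1 f (k * (2 * rdot y (velocity g s *m x))).
  exact: is_deriveZ (is_derive_rdot_refl y x s hg).
have fc : continuous f.
  by apply: derivable_continuous => s; case: (df s).
have dF (s : R) : a <= s <= b -> is_derive s 1 F (D s).
  move=> hs.
  have dA : is_derive s 1 (fun s => asin (f s))
     ((Num.sqrt (1 - f s ^+ 2))^-1 * (k * (2 * rdot y (velocity g s *m x)))).
    apply: (is_derive1_comp (f := asin) (g := f)).
    exact: is_derive1_asin (f1 s hs).
  have := is_deriveZ (- 2^-1) dA.
  rewrite (_ : (- 2^-1) \*: _ = F); last first.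
    apply/funext => r; rewrite /F mulrC -mulNr; exact: erefl.
  by move/is_derive_eq; apply; rewrite /D /GRing.scale /=; move: (Num.sqrt _)^-1 => q; field.
have Dc (s : R) : a <= s <= b -> {for s, continuous D}.
  move=> hs; apply: cvgN; apply: cvgM; first by apply: cvgMl_tmp; exact: continuous_rdot_velocity.
  apply: cvgV; first by rewrite gt_eqF // sqrtr_gt0 sq0.
  apply: (@continuous_comp _ _ _ (fun s => 1 - f s ^+ 2) Num.sqrt s); last exact: sqrt_continuous.
  apply: cvgB; first exact: cvg_cst.
  rewrite expr2; apply: cvgM; exact: fc.
have wD : {within `[a, b], continuous D}.
  apply: continuous_in_subspaceT => s; rewrite inE /= in_itv /= => hs; exact: Dc.
have Fc (s : R) : a <= s <= b -> {for s, continuous F}.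
  by move=> /dF [h _]; apply: differentiable_continuous; apply/derivable1_diffP.
have hF : derivable_oo_LRcontinuous F a b.
  split.
  - by move=> s; rewrite in_itv /= => /andP[/ltW as_ /ltW sb]; have [] := dF s; rewrite ?as_.
  - by apply: cvg_at_right_filter; apply: Fc; rewrite lexx ltW.
  - by apply: cvg_at_left_filter; apply: Fc; rewrite lexx ltW.
have eF : {in `]a, b[, derive1 F =1 D}.
  move=> s; rewrite in_itv /= => /andP[/ltW as_ /ltW sb].
  have h : a <= s <= b by rewrite as_.
  by rewrite derive1E; exact: (@derive_val _ _ _ _ _ _ _ (dF s h)).
have := continuous_FTC2 ab wD hF eF; rewrite -EFinB.
have -> : F b - F a = (asin (f a) - asin (f b)) / 2 by rewrite /F; ring.
move=> <-.
have cpt := @segment_compact R a b.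
have iD := continuous_compact_integrable cpt wD.
have iN : (@lebesgue_measure R).-integrable `[a, b]
    (EFin \o (fun t => spectral_norm (velocity g t))).
  apply: continuous_compact_integrable => //.
  by apply: continuous_subspaceT; exact: continuous_speed.
have sub : `]a, b[ `<=` `[a, b] := @subset_itv_oo_cc _ _ a b.
have iD' : (@lebesgue_measure R).-integrable `]a, b[ (EFin \o D) by exact: integrableS iD.
have iN' : (@lebesgue_measure R).-integrable `]a, b[
    (EFin \o (fun t => spectral_norm (velocity g t))) by exact: integrableS iN.
rewrite (@integral_itv_bndoo _ a b _ true false); last first.
  by case/integrableP: iD' .
apply: le_integral => // s; rewrite inE /= in_itv /= => hs.
rewrite lee_fin; apply: le_trans (rdot_velocity_bound hg x1 y1 hG hs hk).
rewrite /D -mulNr ler_wpM2r ?invr_ge0 ?sqrtr_ge0 //.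
by rewrite -normrN ler_norm.
Qed.

End PieceLowerBound.

Section LengthLowerBound.
Variables (R : realType) (n : nat).
Implicit Types (P Q : 'M[R[i]]_n) (x y : 'cV[R[i]]_n) (g delta : R -> 'M[R[i]]_n).

Let N delta (t : R) : R := spectral_norm (velocity delta t).

Lemma eq_velocity delta g (a b t : R) : (forall s, a <= s <= b -> delta s = g s) -> a < t < b ->
  velocity delta t = velocity g t.
Proof.
move=> h ht; apply/matrixP => i j; rewrite !mxE.
have hn : \near t, a <= t <= b.
  have : t \in `]a, b[ by rewrite in_itv.
  move/near_in_itvoo; apply: filterS => s.
  by rewrite in_itv /= => /andP[/ltW -> /ltW ->].
by congr Complex; rewrite !derive1E; apply: near_eq_derive; apply: filterS hn => s /h ->.
Qed.

Lemma path_lt_last (s : seq R) (a : R) : path <%R a s -> a <= last a s.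
Proof. by elim: s a => //= b s IH a /andP[/ltW ab /IH]; exact: le_trans. Qed.

Lemma partition_variation_le x y (k : R) (s : seq R) (a : R) delta :
  rdot x x = 1 -> rdot y y = 1 -> 0 < k < 1 -> path <%R a s ->
  (forall j, (j < size s)%N -> exists g, smooth g /\
     forall r, (a :: s)`_j <= r <= s`_j -> delta r = g r) ->
  (forall r, a <= r <= last a s -> grassmannian R n (delta r)) ->
  measurable_fun `[a, last a s] (N delta) /\
  (((asin (k * rdot y (refl (delta a) *m x)) -
     asin (k * rdot y (refl (delta (last a s)) *m x))) / 2)%:E <=
   \int[@lebesgue_measure R]_(t in `[a, last a s]) (N delta t)%:E)%E.
Proof.
move=> x1 y1 hk; elim: s a => [|b s IH] a.
  move=> _ _ _ /=; rewrite set_itv1; split; first exact: measurable_fun_set1.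
  by rewrite subrr mul0r; apply: integral_ge0 => t _; rewrite lee_fin spectral_norm_ge0.
move=> /= /andP[ab sbs] hpieces hG.
have [g [hg dg]] := hpieces 0%N isT; rewrite /= in dg.
have bl : b <= last b s by exact: path_lt_last.
have Gab r : a <= r <= b -> grassmannian R n (g r).
  by move=> hr; rewrite -dg //; apply: hG; case/andP: hr => -> /le_trans ->.
have [mbs IHs] : measurable_fun `[b, last b s] (N delta) /\
  (((asin (k * rdot y (refl (delta b) *m x)) -
     asin (k * rdot y (refl (delta (last b s)) *m x))) / 2)%:E <=
   \int[@lebesgue_measure R]_(t in `[b, last b s]) (N delta t)%:E)%E.
  apply: IH => //.
  - by move=> j js; have [g' h'] := hpieces j.+1 js; exists g'.
  - by move=> r /andP[br rl]; apply: hG; rewrite rl (le_trans (ltW ab) br).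
have eN : {in `]a, b[%classic, N g =1 N delta}.
  by move=> t; rewrite inE /= in_itv /= => ht; rewrite /N (eq_velocity dg ht).
have mg : measurable_fun `]a, b[ (N delta).
  apply: eq_measurable_fun eN _; apply: measurable_funTS.
  by apply: continuous_measurable_fun; exact: continuous_speed.
have mab : measurable_fun `[a, b] (N delta) by exact: measurable_fun_itv_cc mg.
have mobs : measurable_fun `]b, last b s] (N delta) by exact: measurable_fun_itv_oc mbs.
have eU : `[a, last b s]%classic = `[a, b] `|` `]b, last b s].
  by apply: itv_bndbnd_setU; rewrite bnd_simp // ltW.
have mU : measurable_fun (`[a, b] `|` `]b, last b s]) (N delta).
  by apply/measurable_funU.
split; first by rewrite eU.
rewrite eU ge0_integral_setU //; last 3 first.
- exact/measurable_EFinP.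
- by move=> t _; rewrite lee_fin spectral_norm_ge0.
- apply/disj_set2P; rewrite -subset0 => t [] /=; rewrite !in_itv /= => /andP[_ tb] /andP[bt _].
  by have := lt_le_trans bt tb; rewrite ltxx.
rewrite integral_itv_obnd_cbnd; last exact/measurable_EFinP.
have := asin_variation_le hg x1 y1 ab Gab hk.
have -> : (\int[@lebesgue_measure R]_(t in `]a, b[) (spectral_norm (velocity g t))%:E =
  \int[@lebesgue_measure R]_(t in `[a, b]) (N delta t)%:E)%E.
  rewrite [RHS](@integral_itv_bndoo _ a b _ true false); last exact/measurable_EFinP.
  by apply: eq_integral => t /eN; rewrite /N => ->.
rewrite -!dg ?lexx ?(ltW ab) // => hab.
apply: le_trans (leeD hab IHs); rewrite -EFinD lee_fin; lra.
Qed.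

Lemma right_limit_ge0 (h : R -> R) (e0 : R) : {for 0, continuous h} -> 0 < e0 ->
  (forall e, 0 < e < e0 -> 0 <= h e) -> 0 <= h 0.
Proof.
move=> hc e00 he; rewrite leNgt; apply/negP => h0.
have /cvgrPdist_lt/(_ (- h 0)) := hc; rewrite oppr_gt0 => /(_ h0) [d /= d0 hd].
pose e := Num.min (d / 2) (e0 / 2).
have e_gt0 : 0 < e by rewrite lt_min !divr_gt0.
have ed : e <= d / 2 by rewrite ge_min lexx.
have ee : e <= e0 / 2 by rewrite ge_min lexx orbT.
have := hd e; rewrite /= sub0r normrN gtr0_norm // => /(_ ltac:(lra)).
have := he e ltac:(lra).
by rewrite ltr_norml; lra.
Qed.

Lemma curve_length_angle_le P Q delta (r : R) : joining_curve P Q delta ->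
  0 <= r <= pi / 2 -> (curve_length delta <= r%:E)%E -> angle_le r P Q.
Proof.
move=> [[s [[sp /eqP sl] hpieces]] hG d0 d1] hr hlen; have pi0 := @pi_gt0 R.
have hP : grassmannian R n P by rewrite -d0; apply: hG; rewrite lexx ler01.
have hQ : grassmannian R n Q by rewrite -d1; apply: hG; rewrite lexx ler01.
apply/angle_leP => //; first by apply: sin_ge0_pi; lra.
apply: rdot_unit_suff => x x1; set y := refl P *m x.
have y1 : rdot y y = 1 by rewrite rdot_refl.
set f := rdot y _.
have hf : -1 <= f <= 1 by apply: rdot_unit_bound => //; rewrite rdot_refl.
have [r_eq|r_neq] := eqVneq r (pi / 2).
  rewrite r_eq (mulr2n (pi / 2)) (_ : pi / 2 + pi / 2 = pi); last by field.
  by rewrite cospi; case/andP: hf.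
have rlt : r < pi / 2 by rewrite lt_neqAle r_neq; case/andP: hr.
pose h (e : R) := cos e * f - cos (e + r *+ 2).
suff : 0 <= h 0 by rewrite /h cos0 add0r mul1r subr_ge0.
have hc : {for 0, continuous h}.
  apply: cvgB; first by apply: cvgMr_tmp; exact: continuous_cos.
  apply: (@continuous_comp _ _ _ (fun e => e + r *+ 2) cos 0); last exact: continuous_cos.
  by apply: cvgD; [exact: cvg_id|exact: cvg_cst].
have e0 : 0 < Num.min (pi / 2) (pi - r *+ 2).
  by rewrite lt_min (mulr2n r); apply/andP; split; lra.
apply: (right_limit_ge0 hc e0) => e; rewrite lt_min (mulr2n r) => /andP[e_gt0 /andP[e1 e2]].
have ce : 0 < cos e < 1.
  rewrite cos_gt0_pihalf /=; last by apply/andP; split; lra.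
  by rewrite -(@cos0 R) ltr_cos ?in_itv /=; try (apply/andP; split); lra.
have sG t : 0 <= t <= last 0 s -> grassmannian R n (delta t) by rewrite sl; exact: hG.
have [_] := partition_variation_le x1 y1 ce sp hpieces sG.
rewrite sl => /le_trans/(_ hlen); rewrite d0 d1 lee_fin -/y y1 mulr1 -/f.
have -> : asin (cos e) = pi / 2 - e.
  have -> : cos e = sin (pi / 2 - e) by rewrite sinB sin_pihalf cos_pihalf; ring.
  by rewrite sinK // in_itv /=; apply/andP; split; lra.
move=> hle; rewrite /h subr_ge0 (mulr2n r).
have cf : -1 <= cos e * f <= 1.
  rewrite -ler_norml normrM; case/andP: ce => c0 c1; rewrite (gtr0_norm c0).
  rewrite -ler_norml in hf; rewrite -[leRHS]mulr1.
  by apply: ler_pM => //; exact: ltW.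
have -> : cos (e + (r + r)) = sin (pi / 2 - (e + (r + r))).
  by rewrite sinB sin_pihalf cos_pihalf; ring.
rewrite -[leRHS]asinK ?in_itv //.
have a1 := asin_lepi2 cf; have a2 := asin_geNpi2 cf.
rewrite le_eqVlt; have [->|ne] := eqVneq (pi / 2 - (e + (r + r))) (asin (cos e * f)).
  by rewrite eqxx.
apply/orP; right; rewrite ltr_sin ?in_itv /=; last 2 first.
- by case/andP: hr => r0 _; apply/andP; split; lra.
- by rewrite a2.
by rewrite lt_neqAle ne /=; lra.
Qed.

Lemma dist_angle_le P Q (r : R) : 0 <= r < pi / 2 ->
  (dist_infty P Q <= r%:E)%E -> angle_le r P Q.
Proof.
move=> /andP[r0 rpi] hd x; rewrite -subr_ge0.
pose h (e : R) := sin (r + e) * l2norm x - l2norm ((P - Q) *m x).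
suff : 0 <= h 0 by rewrite /h addr0.
have hc : {for 0, continuous h}.
  apply: cvgB; last exact: cvg_cst.
  apply: cvgMr_tmp.
  apply: (@continuous_comp _ _ _ (fun e => r + e) sin 0); last exact: continuous_sin.
  by apply: cvgD; [exact: cvg_cst|exact: cvg_id].
apply: (right_limit_ge0 hc (e0 := pi / 2 - r)) => [|e he]; first by rewrite subr_gt0.
have : (dist_infty P Q < (r + e)%:E)%E.
  by apply: le_lt_trans hd _; rewrite lte_fin; lra.
rewrite /dist_infty => /ereal_inf_lt [_ [delta hdelta <-] /ltW hlen].
have := curve_length_angle_le hdelta _ hlen; rewrite subr_ge0.
by move=> /(_ ltac:(lra)) /(_ x).
Qed.

Lemma dist_infty_ge0 P Q : (0 <= dist_infty P Q)%E.
Proof.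
apply: le_ereal_inf_tmp => _ [delta _ <-]; apply: integral_ge0 => t _.
by rewrite lee_fin spectral_norm_ge0.
Qed.

End LengthLowerBound.

(** * Intermediate points *)

Section Intermediate.
Variables (R : realType) (n : nat).
Implicit Types (P Q S : 'M[R[i]]_n).

Lemma asin_lt_piquarter (c : R) : 0 <= c -> c < 1 / Num.sqrt 2 -> c <= 1 /\ asin c < pi / 4.
Proof.
move=> c0 hc; have pi0 := @pi_gt0 R.
have cc : c ^+ 2 < 1 / 2.
  have -> : 1 / 2 = (1 / Num.sqrt 2) ^+ 2 :> R.
    by rewrite expr_div_n expr1n sqr_sqrtr.
  by rewrite ltr_pXn2r ?nnegrE ?divr_ge0 ?sqrtr_ge0.
have c1 : c <= 1.
  by rewrite -(ler_pXn2r (n:=2)) ?nnegrE // expr1n; lra.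
split=> //.
have s4 : sin (pi / 4) ^+ 2 = 1 / 2 :> R.
  have := @cos_mulr2n R (pi / 4); rewrite cos2sin2.
  by rewrite (_ : pi / 4 *+ 2 = pi / 2) ?cos_pihalf; [lra|rewrite (mulr2n (pi / 4)); field].
have s0 : 0 <= sin (pi / 4 : R) by apply: sin_ge0_pi; apply/andP; split; lra.
have cI : -1 <= c <= 1 by rewrite c1 andbT; lra.
rewrite -ltr_sin ?in_itv /=; last 2 first.
- by rewrite asin_geNpi2 // asin_lepi2.
- by apply/andP; split; lra.
by rewrite asinK ?in_itv // -(ltr_pXn2r (n:=2)) ?nnegrE // s4.
Qed.

Lemma is_geodesic_exists P Q (r : R) : grassmannian R n P -> grassmannian R n Q ->
  0 <= r < pi / 2 -> angle_le r P Q -> exists gamma, is_geodesic P Q gamma.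
Proof.
move=> hP hQ hr hPQ; have pi0 := @pi_gt0 R.
have [V [d [hV hd hX hQ1]]] := geodesic_exists hP hQ hr hPQ.
exists (geodesic_curve P (udiag V (fun j => (d j)%:C))); split.
  apply: le_lt_trans (spectral_norm_angle _ hPQ) _.
    by apply: sin_ge0_pi; apply/andP; split; lra.
  by rewrite -sin_pihalf ltr_sin ?in_itv /=; try (apply/andP; split); lra.
exists (udiag V (fun j => (d j)%:C)); split; last exact: erefl.
split; [|exact: hX| |exact: hQ1].
  apply: trmxC_hermsymmx; rewrite udiagC; congr udiag; apply/funext => j.
  exact: conjc_real.
case/andP: hr => r0 rpi; apply: le_lt_trans rpi; apply: spectral_norm_le => // x.
apply: l2norm_udiag_le => // j; rewrite /= expr0n addr0.
by rewrite -(real_normK (num_real (d j))) ler_pXn2r ?nnegrE.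
Qed.

Lemma dist_infty_fin P Q : spectral_norm (P - Q) < 1 / Num.sqrt 2 ->
  grassmannian R n P -> grassmannian R n Q ->
  exists d : R, dist_infty P Q = d%:E /\ 0 <= d < pi / 4.
Proof.
move=> hPQ hP hQ; have pi0 := @pi_gt0 R.
have [N1 aN] := asin_lt_piquarter (spectral_norm_ge0 _) hPQ.
have a0 : 0 <= asin (spectral_norm (P - Q)).
  have cI : -1 <= spectral_norm (P - Q) <= 1.
    by rewrite N1 andbT (le_trans _ (spectral_norm_ge0 _)) ?lerN10.
  rewrite leNgt; apply/negP => alt.
  have : sin (asin (spectral_norm (P - Q))) < sin 0.
    rewrite ltr_sin ?in_itv //=; first by rewrite asin_geNpi2 // asin_lepi2.
    by apply/andP; split; lra.
  by rewrite asinK ?in_itv // sin0 ltNge spectral_norm_ge0.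
have hd : (dist_infty P Q <= (asin (spectral_norm (P - Q)))%:E)%E.
  by apply: angle_le_dist => //; [rewrite a0; lra|exact: angle_le_asin].
have d0 := dist_infty_ge0 P Q.
have dfin : dist_infty P Q \is a fin_num.
  by rewrite ge0_fin_numE //; apply: le_lt_trans hd _; rewrite ltry.
exists (fine (dist_infty P Q)); rewrite fineK //; split=> //.
by rewrite fine_ge0 //=; apply: le_lt_trans aN; rewrite -lee_fin fineK.
Qed.

Lemma dist_infty_triangle_lb P Q S (d a b : R) :
  grassmannian R n P -> grassmannian R n Q -> grassmannian R n S ->
  dist_infty P Q = d%:E -> d = a + b -> 0 <= a -> 0 <= b -> a + b < pi / 2 ->
  angle_le a P S -> angle_le b S Q ->
  dist_infty P S = a%:E /\ dist_infty S Q = b%:E.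
Proof.
move=> hP hQ hS hd dab a0 b0 ab hPS hSQ; have pi0 := @pi_gt0 R.
have ha : (dist_infty P S <= a%:E)%E by apply: angle_le_dist => //; lra.
have hb : (dist_infty S Q <= b%:E)%E by apply: angle_le_dist => //; lra.
have fin A B (c : R) : (dist_infty A B <= c%:E)%E ->
    exists e : R, dist_infty A B = e%:E /\ 0 <= e <= c.
  move=> h; have e0 := dist_infty_ge0 A B.
  have efin : dist_infty A B \is a fin_num.
    by rewrite ge0_fin_numE //; apply: le_lt_trans h _; rewrite ltry.
  by exists (fine (dist_infty A B)); rewrite fineK // fine_ge0 // -lee_fin fineK.
have [a' [ea /andP[a'0 a'a]]] := fin _ _ _ _ ha.
have [b' [eb /andP[b'0 b'b]]] := fin _ _ _ _ hb.
have hPS' : angle_le a' P S by apply: dist_angle_le; rewrite ?ea //; lra.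
have hSQ' : angle_le b' S Q by apply: dist_angle_le; rewrite ?eb //; lra.
have hPQ : angle_le (a' + b') P Q by apply: (angle_le_trans _ _ _ hP hQ hS) => //; lra.
have : (dist_infty P Q <= (a' + b')%:E)%E by apply: angle_le_dist => //; lra.
by rewrite hd lee_fin ea eb => h; split; congr _%:E; lra.
Qed.

End Intermediate.

Theorem proposition5p5 (R : realType) (n : nat) (P Q : 'M[R[i]]_n) (t : R)
    (hP : grassmannian R n P) (hQ : grassmannian R n Q)
    (hPQ : spectral_norm (P - Q) < 1 / Num.sqrt 2)
    (ht : 0 < t < 1) :
  geodesically_convex (intermediate_set t P Q).
Proof.
have pi0 := @pi_gt0 R.
have [d [ed /andP[d0 dpi]]] := dist_infty_fin hPQ hP hQ.
case/andP: ht => t0 t1.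
have td0 : 0 <= t * d by apply: mulr_ge0 => //; exact: ltW.
have sd0 : 0 <= (1 - t) * d by apply: mulr_ge0 => //; lra.
have dE : d = t * d + (1 - t) * d by ring.
have inM S : intermediate_set t P Q S ->
    [/\ grassmannian R n S, angle_le (t * d) P S & angle_le ((1 - t) * d) S Q].
  by rewrite /intermediate_set /= ed => -[hS h1 h2]; split => //;
    apply: dist_angle_le; rewrite ?h1 ?h2 //; lra.
split=> [S []//|R0 R1 M0 M1].
have [h0 h0P h0Q] := inM _ M0; have [h1 h1P h1Q] := inM _ M1.
split=> [|gamma [_ [X [hX ->]]] s hs].
  have [th|th] := leP t (1 / 2).
    have td : t * d <= d / 2 by have := ler_wpM2r d0 th; lra.
    apply: (is_geodesic_exists (r := t * d + t * d) h0 h1); first by lra.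
    by apply: (angle_le_trans _ _ _ h0 h1 hP) => //; [lra|exact: angle_le_sym].
  have td : (1 - t) * d <= d / 2.
    by have := ler_wpM2r d0 (ltW th); lra.
  apply: (is_geodesic_exists (r := (1 - t) * d + (1 - t) * d) h0 h1); first by lra.
  by apply: (angle_le_trans _ _ _ h0 h1 hQ) => //; [lra|exact: angle_le_sym].
have tb : 0 <= t * d < pi / 4 by lra.
have sb : 0 <= (1 - t) * d < pi / 4 by lra.
have [hG hgP] := ball_geodesic_convex hX h0 hP tb hs h0P h1P.
have [_ hgQ] := ball_geodesic_convex hX h0 hQ sb hs (angle_le_sym h0Q) (angle_le_sym h1Q).
have [e1 e2] := dist_infty_triangle_lb hP hQ hG ed dE td0 sd0 ltac:(lra) hgP (angle_le_sym hgQ).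
by split; [exact: hG|rewrite ed e1|rewrite ed e2].
Qed.
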